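(* (Soundness) If a sequent $D\vdash\boldsymbol\Lambda$ is derivable in the proof system, then $D\models\boldsymbol\Lambda$.
   Context: Fix a signature (names $A$ with arities $\mathsf{ar}$) and a countable set of variables. Designs are possibly infinite terms coinductively generated by: positive $P ::= \Omega \mid \bigwedge\{S_i : i\in I\}$ ($I$ arbitrary); predesigns $S ::= N_0\,|\,\overline{a}\langle N_1,\dots,N_n\rangle$ ($\mathsf{ar}(a)=n$); negative $N ::= x \mid \sum a(\vec x).P_a$ (one component $a(\vec x).P_a$ for each $a\in A$, $\vec x$ distinct bound variables of length $\mathsf{ar}(a)$); up to $\alpha$-renaming and set-like treatment of conjunctions, $\bigwedge\{S\}=S$, $\maltese:=\bigwedge\emptyset$. Reduction: $P\rightsquigarrow Q$ iff $P$ has a conjunct $(\sum a(\vec x).P_a)\,|\,\overline b\langle\vec N\rangle$ and $Q=P_b[\vec N/\vec x]$. Normal form (corecursive): $[\![P]\!]=\Omega$ if some reduction sequence from $P$ is infinite or ends in $\Omega$; otherwise $[\![P]\!]$ is the conjunction of all $x\,|\,\overline a\langle[\![\vec N]\!]\rangle$ with $x|\overline a\langle\vec N\rangle$ a conjunct of some $Q$, $P\rightsquigarrow^*Q$; $[\![\sum a(\vec x).P_a]\!]=\sum a(\vec x).[\![P_a]\!]$, $[\![x]\!]=x$. Standard design: $\neq\Omega$ and generated by $P::=\Omega\mid\bigwedge\{S_i\}$, $S::=x\,|\,\overline a\langle N_1,\dots,N_n\rangle$, $N::=\sum a(\vec x).P_a$. Atomic positive: standard, free variables among a fixed variable $x_0$;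 atomic negative: standard and closed. $P\perp N$ iff $[\![P[N/x_0]]\!]=\maltese$; $\mathbf{X}^\perp$ = atomic designs of opposite polarity orthogonal to every element of $\mathbf{X}$; a behaviour is a set $\mathbf{X}$ of atomic designs of one polarity with $\mathbf{X}^{\perp\perp}=\mathbf{X}$. Positive context $\boldsymbol\Gamma=x_1:\mathbf P_1,\dots,x_n:\mathbf P_n$ (distinct variables, positive behaviours), $\mathsf{fv}(\boldsymbol\Gamma)=\{x_1,\dots,x_n\}$; negative context $\boldsymbol\Gamma,\mathbf N$ ($\mathbf N$ a negative behaviour). $P\models\boldsymbol\Gamma$ iff $P$ standard, $\mathsf{fv}(P)\subseteq\mathsf{fv}(\boldsymbol\Gamma)$, and $[\![P[K_1/x_1,\dots,K_n/x_n]]\!]=\maltese$ for all $K_i\in\mathbf P_i^\perp$; $N\models\boldsymbol\Gamma,\mathbf N$ iff $N$ standard, $\mathsf{fv}(N)\subseteq\mathsf{fv}(\boldsymbol\Gamma)$, and $[\![Q[N[K_1/x_1,\dots,K_n/x_n]/x_0]]\!]=\maltese$ for all $K_i\in\mathbf P_i^\perp$, $Q\in\mathbf N^\perp$. Logical connective: $\alpha=(z_1,\dots,z_n,\alpha_0)$, $z_i$ distinct variables, $\alpha_0$ a finite set of negative actions $a(\vec x)$ ($\vec x$ a list of $\mathsf{ar}(a)$ distinct variables among the $z_i$) with distinct names; connectives are identified up to renaming of variables. $\overline a\langle\mathbf N_1,\dots,\mathbf N_m\rangle:=\{x_0\,|\,\overline a\langle N_1,\dots,N_m\rangle: N_j\in\mathbf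 N_j\}$; $\overline\alpha\langle\mathbf N_1,\dots,\mathbf N_n\rangle:=\big(\bigcup_{a(\vec x)\in\alpha_0}\overline a\langle\mathbf N_{i_1},\dots,\mathbf N_{i_m}\rangle\big)^{\perp\perp}$ with $\vec x=z_{i_1},\dots,z_{i_m}$; $\alpha(\mathbf P_1,\dots,\mathbf P_n):=\overline\alpha\langle\mathbf P_1^\perp,\dots,\mathbf P_n^\perp\rangle^\perp$. Logical behaviours are built inductively: $\overline\alpha\langle\mathbf N_1,\dots,\mathbf N_n\rangle$ with $\mathbf N_i$ logical, and $\alpha(\mathbf P_1,\dots,\mathbf P_n)$ with $\mathbf P_i$ logical. A proof is a standard design all of whose conjunctions are unary (in particular containing no $\maltese$). A sequent is either $P\vdash\boldsymbol\Gamma$ with $P$ a positive proof, $\boldsymbol\Gamma$ a positive context of logical behaviours and $\mathsf{fv}(P)\subseteq\mathsf{fv}(\boldsymbol\Gamma)$, or $N\vdash\boldsymbol\Gamma,\mathbf N$ with $N$ a negative proof, $\mathbf N$ a negative logical behaviour and $\mathsf{fv}(N)\subseteq\mathsf{fv}(\boldsymbol\Gamma)$. Inference rules (derivations are finite trees): positive rule $(\overline\alpha,\overline a)$: from $M_j\vdash\boldsymbol\Gamma,\mathbf N_{i_j}$ for $j=1,\dots,m$ infer $z\,|\,\overline a\langle M_1,\dots,M_m\rangle\vdash\boldsymbol\Gamma$, provided $z:\overline\alpha\langle\mathbf N_1,\dots,\mathbf N_n\rangle$ belongs to $\boldsymbol\Gamma$, $a(\vec x)\in\alpha_0$ and $\vec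 x=z_{i_1},\dots,z_{i_m}$; negative rule $(\alpha)$: from $P_a\vdash\boldsymbol\Gamma,z_{i_1}:\mathbf P_{i_1},\dots,z_{i_m}:\mathbf P_{i_m}$ for every $a(\vec x)\in\alpha_0$ (with $\vec x=z_{i_1},\dots,z_{i_m}$ fresh for $\boldsymbol\Gamma$) infer $\sum a(\vec x).P_a\vdash\boldsymbol\Gamma,\alpha(\mathbf P_1,\dots,\mathbf P_n)$, the components $b(\vec y).P_b$ with $b(\vec y)\notin\alpha_0$ being arbitrary. *)

(* Defs.v *)
From Stdlib Require Import List Relations.
From mathcomp Require Import all_boot.
From mathcomp Require Import boolp classical_sets.

Set Implicit Arguments.
Unset Strict Implicit.
Unset Printing Implicit Defensive.

Local Open Scope classical_set_scope.

Record signature := Signature { name :> Type; ar : name -> nat }.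
Arguments ar {s} _.

(* Terms are in de Bruijn notation, which takes care of alpha-renaming: the
   variables are the natural numbers, and the component at [a] of [Sum P]
   binds the variables 0, ..., ar a - 1 of [P a], so that the variable [x] of
   [Sum P] is the variable [x + ar a] of [P a]. *)
CoInductive pos (A : signature) : Type :=
| Omega
| Conj (I : Type) (T : I -> predesign A)
with predesign (A : signature) : Type :=
| Cut (N : neg A) (a : A) (Ns : 'I_(ar a) -> neg A)
with neg (A : signature) : Type :=
| Var (x : nat)
| Sum (P : forall a : A, pos A).

Arguments Omega {A}.
Arguments Conj {A} I T.
Arguments Cut {A} N a Ns.
Arguments Var {A} x.
Arguments Sum {A} P.

Section Designs.
Variable A : signature.

Definition daimon : pos A := Conj void (fun v => match v with end).

(* The identification of a predesign T with /\{T}. *)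
Definition single (T : predesign A) : pos A := Conj unit (fun=> T).

(* Equality of designs: conjunctions are compared as sets. *)

Inductive predesign_rel (RN : neg A -> neg A -> Prop) :
    predesign A -> predesign A -> Prop :=
| CutRel (N M : neg A) (a : A) (Ns Ms : 'I_(ar a) -> neg A) :
    RN N M -> (forall k, RN (Ns k) (Ms k)) ->
    predesign_rel RN (Cut N a Ns) (Cut M a Ms).

Inductive pos_rel (RN : neg A -> neg A -> Prop) : pos A -> pos A -> Prop :=
| OmegaRel : pos_rel RN Omega Omega
| ConjRel (I J : Type) (T : I -> predesign A) (U : J -> predesign A) :
    (forall i, exists j, predesign_rel RN (T i) (U j)) ->
    (forall j, exists i, predesign_rel RN (T i) (U j)) ->
    pos_rel RN (Conj I T) (Conj J U).

Inductive neg_rel (RP : pos A -> pos A -> Prop) : neg A -> neg A -> Prop :=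
| VarRel (x : nat) : neg_rel RP (Var x) (Var x)
| SumRel (P Q : forall a : A, pos A) :
    (forall a, RP (P a) (Q a)) -> neg_rel RP (Sum P) (Sum Q).

Definition bisimulation (RP : pos A -> pos A -> Prop)
    (RN : neg A -> neg A -> Prop) : Prop :=
  (forall P Q, RP P Q -> pos_rel RN P Q) /\
  (forall N M, RN N M -> neg_rel RP N M).

Definition pos_eq (P Q : pos A) : Prop :=
  exists RP RN, bisimulation RP RN /\ RP P Q.

Definition up_ren (m : nat) (r : nat -> nat) (x : nat) : nat :=
  if x < m then x else r (x - m) + m.

CoFixpoint ren_pos (r : nat -> nat) (P : pos A) : pos A :=
  match P with
  | Omega => Omega
  | Conj J T => Conj J (fun i => ren_predesign r (T i))
  end
with ren_predesign (r : nat -> nat) (T : predesign A) : predesign A :=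
  match T with
  | Cut N a Ns => Cut (ren_neg r N) a (fun k => ren_neg r (Ns k))
  end
with ren_neg (r : nat -> nat) (N : neg A) : neg A :=
  match N with
  | Var x => Var (r x)
  | Sum P => Sum (fun a => ren_pos (up_ren (ar a) r) (P a))
  end.

Definition up_subst (m : nat) (s : nat -> neg A) (x : nat) : neg A :=
  if x < m then Var x else ren_neg (addn^~ m) (s (x - m)).

CoFixpoint subst_pos (s : nat -> neg A) (P : pos A) : pos A :=
  match P with
  | Omega => Omega
  | Conj J T => Conj J (fun i => subst_predesign s (T i))
  end
with subst_predesign (s : nat -> neg A) (T : predesign A) : predesign A :=
  match T with
  | Cut N a Ns => Cut (subst_neg s N) a (fun k => subst_neg s (Ns k))
  end
with subst_neg (s : nat -> neg A) (N : neg A) : neg A :=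
  match N with
  | Var x => s x
  | Sum P => Sum (fun a => subst_pos (up_subst (ar a) s) (P a))
  end.

(* Replaces the m bound variables of a component by Ns. *)
Definition instantiate (m : nat) (Ns : 'I_m -> neg A) (x : nat) : neg A :=
  if insub x is Some k then Ns k else Var (x - m).

Inductive fv_pos (x : nat) : pos A -> Prop :=
| FvConj (I : Type) (T : I -> predesign A) (i : I) :
    fv_predesign x (T i) -> fv_pos x (Conj I T)
with fv_predesign (x : nat) : predesign A -> Prop :=
| FvHead (N : neg A) (a : A) (Ns : 'I_(ar a) -> neg A) :
    fv_neg x N -> fv_predesign x (Cut N a Ns)
| FvArg (N : neg A) (a : A) (Ns : 'I_(ar a) -> neg A) (k : 'I_(ar a)) :
    fv_neg x (Ns k) -> fv_predesign x (Cut N a Ns)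
with fv_neg (x : nat) : neg A -> Prop :=
| FvVar : fv_neg x (Var x)
| FvSum (P : forall a : A, pos A) (a : A) :
    fv_pos (x + ar a) (P a) -> fv_neg x (Sum P).

Inductive step : pos A -> pos A -> Prop :=
| Step (I : Type) (T : I -> predesign A) (i : I) (P : forall a : A, pos A)
    (b : A) (Ns : 'I_(ar b) -> neg A) :
    T i = Cut (Sum P) b Ns ->
    step (Conj I T) (subst_pos (instantiate Ns) (P b)).

Definition steps : pos A -> pos A -> Prop := clos_refl_trans_1n _ step.

Definition diverges (P : pos A) : Prop :=
  steps P Omega \/
  exists Q : nat -> pos A, Q 0 = P /\ forall n, step (Q n) (Q n.+1).

Definition index (P : pos A) : Type :=
  match P with Omega => void | Conj J _ => J end.

Definition conjunct (P : pos A) : index P -> predesign A :=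
  match P with
  | Omega => fun v => match v with end
  | Conj _ T => T
  end.

(* The reduct of a cut; the value on head variables is junk, and has no
   conjunct. *)
Definition contract (T : predesign A) : pos A :=
  match T with
  | Cut (Sum P) b Ns => subst_pos (instantiate Ns) (P b)
  | Cut (Var _) _ _ => Omega
  end.

(* The pairs of a reduction sequence from P to some Q and of a conjunct of Q.
   They are coded by the conjuncts contracted along the sequence, not by the
   designs it visits, so as to remain in the universe of the index types of
   conjunctions (see conjunct_normal). *)
Inductive run (P : pos A) : Type :=
| Stop (i : index P)
| Go (i : index P) (r : run (contract (conjunct i))).

Fixpoint run_end (P : pos A) (r : run P) : predesign A :=
  match r with
  | Stop i => conjunct i
  | Go _ r' => run_end r'
  end.

Definition has_head_var (T : predesign A) : bool :=
  if T is Cut (Var _) _ _ then true else false.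

CoFixpoint normal_pos (P : pos A) : pos A :=
  if `[< diverges P >] then Omega
  else Conj {r : run P | has_head_var (run_end r)}
         (fun r => normal_head (run_end (sval r)))
with normal_head (T : predesign A) : predesign A :=
  match T with
  | Cut N a Ns => Cut N a (fun k => normal_neg (Ns k))
  end
with normal_neg (N : neg A) : neg A :=
  match N with
  | Var x => Var x
  | Sum P => Sum (fun a => normal_pos (P a))
  end.

Lemma normal_posE (P : pos A) : ~ diverges P ->
  normal_pos P = Conj {r : run P | has_head_var (run_end r)}
                   (fun r => normal_head (run_end (sval r))).
Proof.
move=> Pconv.
rewrite [LHS](_ : _ = match normal_pos P with
  Omega => Omega | Conj J T => Conj J T end); last by case: (normal_pos P).
by rewrite /=; case: asboolP.
Qed.

Lemma normal_headE (N : neg A) (a : A) (Ns : 'I_(ar a) -> neg A) :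
  normal_head (Cut N a Ns) = Cut N a (fun k => normal_neg (Ns k)).
Proof.
by rewrite [LHS](_ : _ = match normal_head (Cut N a Ns) with
  Cut M b Ms => Cut M b Ms end); last by case: (normal_head _).
Qed.

Lemma step_contract (P : pos A) (i : index P) :
  run (contract (conjunct i)) -> step P (contract (conjunct i)).
Proof.
case: P i => [[]|J T] i /=.
case Ti: (T i) => [[x|R] a Ns] /= r; first by case: r => [[]|[]].
exact: Step Ti.
Qed.

Lemma run_steps (P : pos A) (r : run P) :
  exists (Q : pos A) (i : index Q), steps P Q /\ conjunct i = run_end r.
Proof.
elim: r => {}P i; first by exists P, i; split=> //; left.
move=> r [Q [j [PQ Ej]]]; exists Q, j; split=> //.
by right with (contract (conjunct i)) => //; exact: step_contract.
Qed.

Lemma steps_run (P Q : pos A) (i : index Q) : steps P Q ->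
  exists r : run P, run_end r = conjunct i.
Proof.
move=> PQ; elim: PQ i => {P Q} [P|P R Q PR _ IH] i; first by exists (Stop i).
have [r Er] := IH i; case: PR r Er => {IH P R} I T j P b Ms Tj r Er.
have E : subst_pos (instantiate Ms) (P b) = contract (@conjunct (Conj I T) j).
  by rewrite /= Tj.
move: r Er; rewrite E => r Er; by exists (Go r).
Qed.

Lemma conjunct_normal (P : pos A) (T : predesign A) : ~ diverges P ->
  (exists i : index (normal_pos P), conjunct i = T) <->
  (exists (Q : pos A) (i : index Q) (x : nat) (a : A)
          (Ns : 'I_(ar a) -> neg A),
     [/\ steps P Q, conjunct i = Cut (Var x) a Ns
       & T = Cut (Var x) a (fun k => normal_neg (Ns k))]).
Proof.
move=> /normal_posE -> /=; split.
- case=> -[r hr] <- /=; have [Q [i [PQ Ei]]] := run_steps r.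
  move: hr; rewrite -Ei; case E: (conjunct i) => [[x|R] a Ns] //= _.
  by exists Q, i, x, a, Ns; rewrite normal_headE.
- case=> Q [i [x [a [Ns [PQ Ei ->]]]]]; have [r Er] := steps_run i PQ.
  have hr : has_head_var (run_end r) by rewrite Er Ei.
  by exists (exist _ r hr); rewrite /= Er Ei normal_headE.
Qed.

(* Standard designs; as for designs, the grammar is read coinductively. *)

CoInductive std_pos : pos A -> Prop :=
| StdOmega : std_pos Omega
| StdConj (I : Type) (T : I -> predesign A) :
    (forall i, std_predesign (T i)) -> std_pos (Conj I T)
with std_predesign : predesign A -> Prop :=
| StdCut (x : nat) (a : A) (Ns : 'I_(ar a) -> neg A) :
    (forall k, std_neg (Ns k)) -> std_predesign (Cut (Var x) a Ns)
with std_neg : neg A -> Prop :=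
| StdSum (P : forall a : A, pos A) :
    (forall a, std_pos (P a)) -> std_neg (Sum P).

Definition standard_pos (P : pos A) : Prop := P <> Omega /\ std_pos P.
Definition standard_neg (N : neg A) : Prop := std_neg N.

Definition x0 : nat := 0.

Definition atomic_pos (P : pos A) : Prop :=
  standard_pos P /\ forall x, fv_pos x P -> x = x0.
Definition atomic_neg (N : neg A) : Prop :=
  standard_neg N /\ forall x, ~ fv_neg x N.

(* P[N/x0] *)
Definition plug (P : pos A) (N : neg A) : pos A :=
  subst_pos (fun x => if x == x0 then N else Var x) P.

Definition orthogonal (P : pos A) (N : neg A) : Prop :=
  pos_eq (normal_pos (plug P N)) daimon.

Definition orth_pos (X : set (pos A)) : set (neg A) :=
  [set N | atomic_neg N /\ forall P, X P -> orthogonal P N].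
Definition orth_neg (X : set (neg A)) : set (pos A) :=
  [set P | atomic_pos P /\ forall N, X N -> orthogonal P N].

Definition pos_behaviour (X : set (pos A)) : Prop := orth_neg (orth_pos X) = X.
Definition neg_behaviour (X : set (neg A)) : Prop := orth_pos (orth_neg X) = X.

(* Logical connectives. As they are identified up to renaming, the variables
   z_1, ..., z_n are represented by the elements of 'I_n. *)

Record action (n : nat) := Action {
  act_name : A;
  act_vars : 'I_(ar act_name) -> 'I_n;
  act_vars_inj : injective act_vars }.

Record connective := Connective {
  arity : nat;
  actions : list (action arity);
  actions_distinct : NoDup (List.map (@act_name arity) actions) }.

Definition pos_action (a : A) (Ns : 'I_(ar a) -> set (neg A)) : set (pos A) :=
  [set P | exists2 M : 'I_(ar a) -> neg A,
      forall k, Ns k (M k) & pos_eq P (single (Cut (Var x0) a M))].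

Definition pos_connective (al : connective)
    (Ns : 'I_(arity al) -> set (neg A)) : set (pos A) :=
  orth_neg (orth_pos
    [set P | exists2 c : action (arity al), In c (actions al)
           & pos_action (fun k => Ns (act_vars (a := c) k)) P]).

Definition neg_connective (al : connective)
    (Ps : 'I_(arity al) -> set (pos A)) : set (neg A) :=
  orth_pos (pos_connective (fun i => orth_pos (Ps i))).

Inductive logical_pos : set (pos A) -> Prop :=
| LogicalPos (al : connective) (Ns : 'I_(arity al) -> set (neg A)) :
    (forall i, logical_neg (Ns i)) -> logical_pos (pos_connective Ns)
with logical_neg : set (neg A) -> Prop :=
| LogicalNeg (al : connective) (Ps : 'I_(arity al) -> set (pos A)) :
    (forall i, logical_pos (Ps i)) -> logical_neg (neg_connective Ps).

Definition context : Type := seq (nat * set (pos A)).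

Definition context_vars (G : context) : seq nat := [seq e.1 | e <- G].

Definition pos_context (G : context) : Prop :=
  uniq (context_vars G) /\ forall x X, In (x, X) G -> pos_behaviour X.

Definition logical_context (G : context) : Prop :=
  uniq (context_vars G) /\ forall x X, In (x, X) G -> logical_pos X.

(* The substitution [K_1/x_1, ..., K_n/x_n] for K_i orthogonal to P_i. *)
Definition realizes (G : context) (K : nat -> neg A) : Prop :=
  (forall x X, In (x, X) G -> orth_pos X (K x)) /\
  (forall x, x \notin context_vars G -> K x = Var x).

(* The pairs D, Lambda of a design and a context of the same polarity. *)
Inductive judgement :=
| PosJ (P : pos A) (G : context)
| NegJ (N : neg A) (G : context) (X : set (neg A)).

Definition models (j : judgement) : Prop :=
  match j with
  | PosJ P G =>
      [/\ pos_context G,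
          standard_pos P,
          forall x, fv_pos x P -> x \in context_vars G
        & forall K, realizes G K ->
            pos_eq (normal_pos (subst_pos K P)) daimon]
  | NegJ N G X =>
      [/\ pos_context G /\ neg_behaviour X,
          standard_neg N,
          forall x, fv_neg x N -> x \in context_vars G
        & forall K Q, realizes G K -> orth_neg X Q ->
            pos_eq (normal_pos (plug Q (subst_neg K N))) daimon]
  end.

(* Designs all of whose conjunctions are unary (as sets). *)
CoInductive unary_pos : pos A -> Prop :=
| UnaryOmega : unary_pos Omega
| UnaryConj (I : Type) (T : I -> predesign A) :
    (exists U, pos_eq (Conj I T) (single U)) ->
    (forall i, unary_predesign (T i)) -> unary_pos (Conj I T)
with unary_predesign : predesign A -> Prop :=
| UnaryCut (N : neg A) (a : A) (Ns : 'I_(ar a) -> neg A) :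
    unary_neg N -> (forall k, unary_neg (Ns k)) -> unary_predesign (Cut N a Ns)
with unary_neg : neg A -> Prop :=
| UnaryVar (x : nat) : unary_neg (Var x)
| UnarySum (P : forall a : A, pos A) :
    (forall a, unary_pos (P a)) -> unary_neg (Sum P).

Definition pos_proof (P : pos A) : Prop := standard_pos P /\ unary_pos P.
Definition neg_proof (N : neg A) : Prop := standard_neg N /\ unary_neg N.

Definition sequent (j : judgement) : Prop :=
  match j with
  | PosJ P G =>
      [/\ pos_proof P, logical_context G
        & forall x, fv_pos x P -> x \in context_vars G]
  | NegJ N G X =>
      [/\ neg_proof N, logical_context G, logical_neg X
        & forall x, fv_neg x N -> x \in context_vars G]
  end.

(* The context Gamma, z_{i_1} : P_{i_1}, ..., z_{i_m} : P_{i_m} of the body of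
   the component a(z_{i_1}, ..., z_{i_m}), in which the free variables are
   shifted by m. *)
Definition extend_context (G : context) (n : nat) (c : action n)
    (Ps : 'I_n -> set (pos A)) : context :=
  [seq (e.1 + ar (act_name c), e.2) | e <- G] ++
  [seq (nat_of_ord k, Ps (act_vars k)) | k <- enum 'I_(ar (act_name c))].

(* The side condition [sequent] is only stated for conclusions: premises are
   conclusions of other rules. The conclusion of PosRule is any design equal to
   z | a<M>, that is with any representation of the unary conjunction. *)
Inductive derivable : judgement -> Prop :=
| PosRule (P : pos A) (G : context) (z : nat) (al : connective)
    (Ns : 'I_(arity al) -> set (neg A)) (c : action (arity al))
    (M : 'I_(ar (act_name c)) -> neg A) :
    sequent (PosJ P G) ->
    (forall i, logical_neg (Ns i)) ->
    In (z, pos_connective Ns) G ->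
    In c (actions al) ->
    pos_eq P (single (Cut (Var z) (act_name c) M)) ->
    (forall k, derivable (NegJ (M k) G (Ns (act_vars k)))) ->
    derivable (PosJ P G)
| NegRule (P : forall a : A, pos A) (G : context) (al : connective)
    (Ps : 'I_(arity al) -> set (pos A)) :
    sequent (NegJ (Sum P) G (neg_connective Ps)) ->
    (forall i, logical_pos (Ps i)) ->
    (forall c, In c (actions al) ->
       derivable (PosJ (P (act_name c)) (extend_context G c Ps))) ->
    derivable (NegJ (Sum P) G (neg_connective Ps)).

End Designs.

(* Main.v *)
(* A positive design normalizes to the daimon iff it does not diverge and reaches
   no conjunct with a head variable, so everything reduces to showing that
   replacing subdesigns by their normal forms changes neither property. Given
   this, in the positive rule each premise M, closed by K, may be replaced by
   [[M[K]]], which is atomic and lies in its behaviour by biorthogonality; in the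
   negative rule [[N[K]]] is tested against the generators of the dual behaviour
   only, where one reduction step leads to a premise. *)

From Stdlib Require Import List Relations.
From mathcomp Require Import all_boot.
From mathcomp Require Import boolp classical_sets.
Require Import Defs.

Set Implicit Arguments.
Unset Strict Implicit.
Unset Printing Implicit Defensive.

(** Normalizing a subdesign is not a local change: during reduction the subdesign is copied, erased
    or itself substituted into, and its own cuts are then met among those of the context. So [sim]
    is closed under simultaneous substitution, and the critical event is the one where, in [P[s]], a
    head variable of [P] becomes a cut against the design that [s] puts there. [step_substP],
    [diverges_substP] and [reach_substP] isolate this event. Divergence then passes along [sim] by
    coinduction, with at least one step per round, and conjuncts with a head variable pass by
    induction on the length of the reduction. Designs are coinductive and conjunctions are sets, so
    laws such as those of substitution hold only up to bisimilarity, under which reduction,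
    divergence and goodness must be shown invariant. Closing a premise by [K] creates cuts, so the
    result is not standard; its normal form is, thanks to the invariant [idfree], which survives
    substitution and reduction where standardness does not. *)

Section Soundness.
Variable A : signature.
Implicit Types (P Q R : pos A) (T U : predesign A) (N M : neg A).
Implicit Types (s : nat -> neg A) (r : nat -> nat).

Lemma pos_unfold P :
  P = match P with Omega => Omega | Conj J T => Conj J T end.
Proof. by case: P. Qed.

Lemma predesign_unfold T : T = match T with Cut N a Ns => Cut N a Ns end.
Proof. by case: T. Qed.

Lemma neg_unfold N : N = match N with Var x => Var x | Sum P => Sum P end.
Proof. by case: N. Qed.

(** * Bisimilarity *)

Definition neg_eq N M : Prop :=
  exists RP RN, bisimulation RP RN /\ RN N M.
Definition predesign_eq : predesign A -> predesign A -> Prop :=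
  predesign_rel neg_eq.

(** Inversion is phrased as a match on the left design: the arguments come back at the same name
    [a], with no equality of dependent pairs to eliminate. *)
Lemma predesign_relP (RN : neg A -> neg A -> Prop) T U :
  predesign_rel RN T U ->
  match T with
  | Cut N a Ns => exists M Ms,
      [/\ U = Cut M a Ms, RN N M & forall k, RN (Ns k) (Ms k)]
  end.
Proof. by case=> N M a Ns Ms NM NsMs; exists M, Ms. Qed.

Lemma pos_relP (RN : neg A -> neg A -> Prop) P Q :
  pos_rel RN P Q ->
  match P with
  | Omega => Q = Omega
  | Conj J T => exists K (U : K -> predesign A),
      [/\ Q = Conj K U, forall i, exists j, predesign_rel RN (T i) (U j)
        & forall j, exists i, predesign_rel RN (T i) (U j)]
  end.
Proof. by case=> // I J T U TU UT; exists J, U. Qed.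

Lemma neg_relP (RP : pos A -> pos A -> Prop) N M :
  neg_rel RP N M ->
  match N with
  | Var x => M = Var x
  | Sum P => exists2 Q : forall a, pos A, M = Sum Q & forall a, RP (P a) (Q a)
  end.
Proof. by case=> // P Q PQ; exists Q. Qed.

Lemma predesign_rel_mono (RN RN' : neg A -> neg A -> Prop) T U :
  (forall N M, RN N M -> RN' N M) -> predesign_rel RN T U ->
  predesign_rel RN' T U.
Proof. by move=> sRN [N M a Ns Ms NM NsMs]; split=> [|k]; apply: sRN. Qed.

Lemma pos_rel_mono (RN RN' : neg A -> neg A -> Prop) P Q :
  (forall N M, RN N M -> RN' N M) -> pos_rel RN P Q -> pos_rel RN' P Q.
Proof.
move=> sRN [|I J T U TU UT]; first exact: OmegaRel.
apply: ConjRel => [i|j].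
- by have [j TUj] := TU i; exists j; apply: predesign_rel_mono TUj.
- by have [i TUi] := UT j; exists i; apply: predesign_rel_mono TUi.
Qed.

Lemma neg_rel_mono (RP RP' : pos A -> pos A -> Prop) N M :
  (forall P Q, RP P Q -> RP' P Q) -> neg_rel RP N M -> neg_rel RP' N M.
Proof.
by move=> sRP [x|P Q PQ]; [exact: VarRel | apply: SumRel => a; apply: sRP].
Qed.

Lemma pos_eq_unfold P Q : pos_eq P Q -> pos_rel neg_eq P Q.
Proof.
case=> RP [RN [[bP bN] PQ]]; apply: pos_rel_mono (bP _ _ PQ) => N M NM.
by exists RP, RN.
Qed.

Lemma neg_eq_unfold N M : neg_eq N M -> neg_rel (@pos_eq A) N M.
Proof.
case=> RP [RN [[bP bN] NM]]; apply: neg_rel_mono (bN _ _ NM) => P Q PQ.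
by exists RP, RN.
Qed.

(** Coinduction up to bisimilarity. The escape [neg_eq N M], without a step, serves the variables:
    two traversals may send a variable to bisimilar designs that need not be related by [RN]. *)
Lemma bisim_upto (RP : pos A -> pos A -> Prop) (RN : neg A -> neg A -> Prop) :
  (forall P Q, RP P Q -> pos_rel (fun N M => RN N M \/ neg_eq N M) P Q) ->
  (forall N M, RN N M ->
     neg_eq N M \/ neg_rel (fun P Q => RP P Q \/ pos_eq P Q) N M) ->
  (forall P Q, RP P Q -> pos_eq P Q) /\ (forall N M, RN N M -> neg_eq N M).
Proof.
move=> hP hN.
have B : bisimulation (fun P Q => RP P Q \/ pos_eq P Q)
                      (fun N M => RN N M \/ neg_eq N M).
  have hE N M : neg_eq N M -> neg_rel (fun P Q => RP P Q \/ pos_eq P Q) N M.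
    by move=> /neg_eq_unfold; apply: neg_rel_mono; right.
  split=> [P Q [/hP //|/pos_eq_unfold]|N M [/hN[]|] //].
  - by apply: pos_rel_mono; right.
  - exact: hE.
  - exact: hE.
by split=> [P Q PQ|N M NM]; do 2 eexists; split; [exact: B|left|exact: B|left].
Qed.

Lemma pos_eq_fold P Q : pos_rel neg_eq P Q -> pos_eq P Q.
Proof.
have [h _] := @bisim_upto (pos_rel neg_eq) (fun _ _ => False)
  (fun P Q => @pos_rel_mono _ _ _ _ (fun _ _ => @or_intror _ _))
  (fun N M F => False_ind _ F).
exact: h.
Qed.

Lemma predesign_rel_refl (RN : neg A -> neg A -> Prop) T :
  (forall N, RN N N) -> predesign_rel RN T T.
Proof. by case: T => N a Ns h; split. Qed.

Lemma pos_rel_refl (RN : neg A -> neg A -> Prop) P :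
  (forall N, RN N N) -> pos_rel RN P P.
Proof.
case: P => [|I T] h; first exact: OmegaRel.
by apply: ConjRel => i; exists i; apply: predesign_rel_refl.
Qed.

Lemma eq_bisim : bisimulation (A := A) eq eq.
Proof.
split=> [P _ <-|N _ <-]; first exact: pos_rel_refl.
by case: N => [x|P]; [exact: VarRel|exact: SumRel].
Qed.

Lemma pos_eq_refl P : pos_eq P P.
Proof. by exists eq, eq; split=> //; exact: eq_bisim. Qed.

Lemma neg_eq_refl N : neg_eq N N.
Proof. by exists eq, eq; split=> //; exact: eq_bisim. Qed.
Hint Resolve pos_eq_refl neg_eq_refl : core.

Lemma predesign_eq_refl T : predesign_eq T T.
Proof. exact: predesign_rel_refl. Qed.
Hint Resolve predesign_eq_refl : core.

Lemma predesign_rel_sym (RN : neg A -> neg A -> Prop) T U :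
  predesign_rel RN T U -> predesign_rel (fun N M => RN M N) U T.
Proof. by case. Qed.

Lemma bisim_sym (RP : pos A -> pos A -> Prop) (RN : neg A -> neg A -> Prop) :
  bisimulation RP RN ->
  bisimulation (fun P Q => RP Q P) (fun N M => RN M N).
Proof.
case=> bP bN; split=> [P Q /bP|N M /bN].
- case=> [|I J T U TU UT]; first exact: OmegaRel.
  apply: ConjRel => [j|i].
  + by have [i /predesign_rel_sym] := UT j; exists i.
  + by have [j /predesign_rel_sym] := TU i; exists j.
- by case=> [x|P Q PQ]; [exact: VarRel|exact: SumRel].
Qed.

Lemma pos_eq_sym P Q : pos_eq P Q -> pos_eq Q P.
Proof.
by case=> RP [RN [B PQ]]; do 2 eexists; split; [exact: bisim_sym B|].
Qed.

Lemma neg_eq_sym N M : neg_eq N M -> neg_eq M N.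
Proof.
by case=> RP [RN [B PQ]]; do 2 eexists; split; [exact: bisim_sym B|].
Qed.

Lemma predesign_eq_sym T U : predesign_eq T U -> predesign_eq U T.
Proof.
by move/predesign_rel_sym; apply: predesign_rel_mono => N M /neg_eq_sym.
Qed.

Lemma predesign_rel_trans (R1 R2 R3 : neg A -> neg A -> Prop) T U V :
  (forall N M L, R1 N M -> R2 M L -> R3 N L) ->
  predesign_rel R1 T U -> predesign_rel R2 U V -> predesign_rel R3 T V.
Proof.
move=> h [N M a Ns Ms NM NsMs] /predesign_relP[L [Ls [-> ML MsLs]]].
by split=> [|k]; [exact: h ML|exact: h (MsLs k)].
Qed.

Lemma bisim_comp (RP RP' : pos A -> pos A -> Prop)
    (RN RN' : neg A -> neg A -> Prop) :
  bisimulation RP RN -> bisimulation RP' RN' ->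
  bisimulation (fun P R => exists2 Q, RP P Q & RP' Q R)
               (fun N L => exists2 M, RN N M & RN' M L).
Proof.
case=> bP bN [bP' bN']; split.
- move=> P R [Q /bP PQ /bP'].
  case: PQ => [|I J T U TU UT] /pos_relP; first by move->; exact: OmegaRel.
  case=> K [V [-> UV VU]]; apply: ConjRel => [i|k].
  + have [j TUj] := TU i; have [k UVk] := UV j.
    by exists k; apply: predesign_rel_trans TUj UVk => L M L'; exists M.
  + have [j UVj] := VU k; have [i TUi] := UT j.
    by exists i; apply: predesign_rel_trans TUi UVj => L M L'; exists M.
- move=> N L [M /bN NM /bN'].
  case: NM => [x|P Q PQ] /neg_relP; first by move->; exact: VarRel.
  by case=> R -> QR; apply: SumRel => a; exists (Q a).
Qed.

Lemma pos_eq_trans Q P R : pos_eq P Q -> pos_eq Q R -> pos_eq P R.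
Proof.
move=> [RP [RN [B PQ]]] [RP' [RN' [B' QR]]].
by do 2 eexists; split; [exact: bisim_comp B B'|exists Q].
Qed.

Lemma neg_eq_trans M N L : neg_eq N M -> neg_eq M L -> neg_eq N L.
Proof.
move=> [RP [RN [B NM]]] [RP' [RN' [B' ML]]].
by do 2 eexists; split; [exact: bisim_comp B B'|exists M].
Qed.

Lemma predesign_eq_trans U T V :
  predesign_eq T U -> predesign_eq U V -> predesign_eq T V.
Proof. by apply: predesign_rel_trans => N M L; exact: neg_eq_trans. Qed.

(** * Renamings and substitutions *)

(* Renamings, substitutions and their composites are all determined by what
   they do on variables and under binders, so a single coinduction proves all
   the laws of substitution. *)
Record traversal := Traversal {
  param : Type;
  up : nat -> param -> param;
  on_var : param -> nat -> neg A;
  tr_pos : param -> pos A -> pos A;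
  tr_predesign : param -> predesign A -> predesign A;
  tr_neg : param -> neg A -> neg A;
  tr_Omega : forall t, tr_pos t Omega = Omega;
  tr_Conj : forall t I (T : I -> predesign A),
    tr_pos t (Conj I T) = Conj I (fun i => tr_predesign t (T i));
  tr_Cut : forall t N a Ns,
    tr_predesign t (Cut N a Ns) = Cut (tr_neg t N) a (fun k => tr_neg t (Ns k));
  tr_Var : forall t x, tr_neg t (Var x) = on_var t x;
  tr_Sum : forall t (P : forall a, pos A),
    tr_neg t (Sum P) = Sum (fun a => tr_pos (up (ar a) t) (P a)) }.

Definition ren_traversal : traversal.
Proof.
refine (@Traversal _ up_ren (fun r x => Var (r x)) (@ren_pos A)
  (@ren_predesign A) (@ren_neg A) _ _ _ _ _) => *;
  by [rewrite [LHS]pos_unfold|rewrite [LHS]predesign_unfold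
     |rewrite [LHS]neg_unfold].
Defined.

Definition subst_traversal : traversal.
Proof.
refine (@Traversal _ (@up_subst A) (fun s x => s x) (@subst_pos A)
  (@subst_predesign A) (@subst_neg A) _ _ _ _ _) => *.
- by rewrite [LHS]pos_unfold.
- by rewrite [LHS]pos_unfold.
- by rewrite [LHS]predesign_unfold.
- by rewrite [LHS]neg_unfold [RHS]neg_unfold.
- by rewrite [LHS]neg_unfold.
Defined.

Lemma substE s :
  (subst_pos s Omega = Omega) *
  (forall I (T : I -> predesign A),
      subst_pos s (Conj I T) = Conj I (fun i => subst_predesign s (T i)))
  * (forall N a Ns, subst_predesign s (Cut N a Ns)
      = Cut (subst_neg s N) a (fun k => subst_neg s (Ns k)))
  * (forall x, subst_neg s (Var x) = s x)
  * (forall (P : forall a, pos A), subst_neg s (Sum P)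
      = Sum (fun a => subst_pos (up_subst (ar a) s) (P a))).
Proof.
do !split => *; [exact: (@tr_Omega subst_traversal)|
 exact: (@tr_Conj subst_traversal)|exact: (@tr_Cut subst_traversal)|
 exact: (@tr_Var subst_traversal)|exact: (@tr_Sum subst_traversal)].
Qed.

Lemma ren_Var r x : ren_neg r (@Var A x) = Var (r x).
Proof. exact: (@tr_Var ren_traversal). Qed.

Definition id_traversal : traversal.
Proof.
refine (@Traversal unit (fun _ _ => tt) (fun _ => Var) (fun _ => id)
  (fun _ => id) (fun _ => id) _ _ _ _ _) => //.
Defined.

Definition comp_traversal (F G : traversal) : traversal.
Proof.
refine (@Traversal (param F * param G)
  (fun m t => (up m t.1, up m t.2)) (fun t x => tr_neg t.1 (on_var t.2 x))
  (fun t P => tr_pos t.1 (tr_pos t.2 P))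
  (fun t T => tr_predesign t.1 (tr_predesign t.2 T))
  (fun t N => tr_neg t.1 (tr_neg t.2 N)) _ _ _ _ _) => *.
- by rewrite !tr_Omega.
- by rewrite !tr_Conj.
- by rewrite !tr_Cut.
- by rewrite !tr_Var.
- by rewrite !tr_Sum.
Defined.

Definition up_pred (m : nat) (X : nat -> Prop) (x : nat) : Prop :=
  x < m \/ X (x - m).

Lemma fv_up_pred (X : nat -> Prop) (P : forall a : A, pos A) (a : A) x :
  (forall x, fv_neg x (Sum P) -> X x) -> fv_pos x (P a) ->
  up_pred (ar a) X x.
Proof.
move=> h fvP; have [xm|mx] := ltnP x (ar a); [by left|right].
by apply: h; apply: (@FvSum _ _ _ a); rewrite subnK.
Qed.

Section Coincidence.
Variables (F G : traversal).
Variable E : (nat -> Prop) -> param F -> param G -> Prop.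
Hypothesis E_up : forall m X t u, E X t u -> E (up_pred m X) (up m t) (up m u).
Hypothesis E_var : forall X t u x,
  E X t u -> X x -> neg_eq (on_var t x) (on_var u x).

(** The predicate [X] bounds the free variables, so [E] may relate parameters that agree only there;
    this yields the coincidence lemma and the congruence for bisimilarity at once. The candidate
    relations quantify over the parameters because these change under each binder. *)
Lemma traversal_eq :
  (forall X t u P Q, E X t u -> (forall x, fv_pos x P -> X x) -> pos_eq P Q ->
     pos_eq (tr_pos t P) (tr_pos u Q)) /\
  (forall X t u N M, E X t u -> (forall x, fv_neg x N -> X x) -> neg_eq N M ->
     neg_eq (tr_neg t N) (tr_neg u M)).
Proof.
pose RP P' Q' := exists X t u P Q, [/\ E X t u, forall x, fv_pos x P -> X x,
  pos_eq P Q, P' = tr_pos t P & Q' = tr_pos u Q].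
pose RN N' M' := exists X t u N M, [/\ E X t u, forall x, fv_neg x N -> X x,
  neg_eq N M, N' = tr_neg t N & M' = tr_neg u M].
have [hP hN] : (forall P Q, RP P Q -> pos_eq P Q) /\
               (forall N M, RN N M -> neg_eq N M).
  apply: bisim_upto.
  - move=> _ _ [X [t [u [P [Q [tu + /pos_eq_unfold PQ -> ->]]]]]].
    case: PQ => [|I J T U TU UT] fvX; first by rewrite !tr_Omega; exact: OmegaRel.
    have hTU i j : predesign_eq (T i) (U j) -> predesign_rel
      (fun N M => RN N M \/ neg_eq N M)
      (tr_predesign t (T i)) (tr_predesign u (U j)).
      case Ti: (T i) => [N a Ns] /predesign_relP[M [Ms [-> NM NsMs]]].
      rewrite !tr_Cut; split=> [|k]; left.
      - exists X, t, u, N, M; split=> // x fx.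
        by apply: fvX; apply: (@FvConj _ _ _ _ i); rewrite Ti; exact: FvHead.
      - exists X, t, u, (Ns k), (Ms k); split=> // x fx.
        by apply: fvX; apply: (@FvConj _ _ _ _ i); rewrite Ti; exact: FvArg fx.
    rewrite !tr_Conj; apply: ConjRel => [i|j].
    + by have [j /hTU] := TU i; exists j.
    + by have [i /hTU] := UT j; exists i.
  - move=> _ _ [X [t [u [N [M [tu + /neg_eq_unfold NM -> ->]]]]]].
    case: NM => [x|P Q PQ] fvX.
      by left; rewrite !tr_Var; apply: E_var tu _; apply: fvX; exact: FvVar.
    right; rewrite !tr_Sum; apply: SumRel => a; left.
    exists (up_pred (ar a) X), (up (ar a) t), (up (ar a) u), (P a), (Q a).
    by split; [exact: E_up| move=> x; exact: fv_up_pred |exact: PQ| |].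
split=> [X t u P Q tu fvX PQ|X t u N M tu fvX NM].
- by apply: hP; do 5 eexists; split; eauto.
- by apply: hN; do 5 eexists; split; eauto.
Qed.

End Coincidence.

Section FullCoincidence.
Variables (F G : traversal).
Variable E : param F -> param G -> Prop.
Hypothesis E_up : forall m t u, E t u -> E (up m t) (up m u).
Hypothesis E_var : forall t u x, E t u -> neg_eq (on_var t x) (on_var u x).

Lemma traversal_eq_full t u : E t u ->
  (forall P, pos_eq (tr_pos t P) (tr_pos u P)) /\
  (forall N, neg_eq (tr_neg t N) (tr_neg u N)).
Proof.
move=> tu; have [|X t' u' x []|hP hN] :=
  @traversal_eq F G (fun X t u => E t u /\ forall x, X x).
- move=> m X t' u' [/E_up tu' hX]; split=> // x; right; exact: hX.
- by move=> /E_var.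
by split=> [P|N]; [apply: (hP xpredT)|apply: (hN xpredT)].
Qed.

End FullCoincidence.

Lemma ren_eq r N M : neg_eq N M -> neg_eq (ren_neg r N) (ren_neg r M).
Proof.
have [m X t u -> //|X t u x -> //|_ hN NM] :=
  @traversal_eq ren_traversal ren_traversal (fun _ => eq).
exact: (hN xpredT).
Qed.

Lemma subst_eq_fv s s' :
  (forall P Q, (forall x, fv_pos x P -> neg_eq (s x) (s' x)) -> pos_eq P Q ->
     pos_eq (subst_pos s P) (subst_pos s' Q)) /\
  (forall N M, (forall x, fv_neg x N -> neg_eq (s x) (s' x)) -> neg_eq N M ->
     neg_eq (subst_neg s N) (subst_neg s' M)).
Proof.
have [m X t u tu x Xx|X t u x tu /tu //|hP hN] :=
  @traversal_eq subst_traversal subst_traversal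
    (fun X s s' => forall x, X x -> neg_eq (s x) (s' x)).
- rewrite /= /up_subst; case: Xx => [-> //|Xx].
  by case: ltnP => // _; apply: ren_eq; apply: tu.
split=> [P Q|N M] fvX PQ.
- exact: (hP _ s s' _ _ fvX).
- exact: (hN _ s s' _ _ fvX).
Qed.

Lemma ren_ren r r' r'' : (forall x, r'' x = r (r' x)) ->
  forall N, neg_eq (ren_neg r (ren_neg r' N)) (ren_neg r'' N).
Proof.
move=> E; have [m t u tu x|t u x /= tu||_ //] := @traversal_eq_full
  (comp_traversal ren_traversal ren_traversal) ren_traversal
  (fun t r'' => forall x, r'' x = t.1 (t.2 x)) _ _ (r, r') r''.
- rewrite /= /up_ren; case: ltnP => [-> //|mx].
  by rewrite ltnNge leq_addl /= addnK tu.
- by rewrite ren_Var tu.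
- by [].
Qed.

Lemma subst_ren s r s' : (forall x, s' x = s (r x)) ->
  forall N, neg_eq (subst_neg s (ren_neg r N)) (subst_neg s' N).
Proof.
move=> E; have [m t u tu x|t u x /= tu||_ //] := @traversal_eq_full
  (comp_traversal subst_traversal ren_traversal) subst_traversal
  (fun t s' => forall x, s' x = t.1 (t.2 x)) _ _ (s, r) s'.
- rewrite /= /up_ren /up_subst; case: ltnP => [-> //|mx].
  by rewrite ltnNge leq_addl /= addnK tu.
- by rewrite substE /= tu.
- by [].
Qed.

Lemma ren_subst r s s' : (forall x, neg_eq (s' x) (ren_neg r (s x))) ->
  forall N, neg_eq (ren_neg r (subst_neg s N)) (subst_neg s' N).
Proof.
move=> E; have [m t u tu x|t u x /= tu||_ //] := @traversal_eq_full
  (comp_traversal ren_traversal subst_traversal) subst_traversal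
  (fun t s' => forall x, neg_eq (s' x) (ren_neg t.1 (t.2 x))) _ _ (r, s) s'.
- rewrite /= /up_subst; case: ltnP => mx.
    by rewrite ren_Var /= /up_ren mx.
  apply: neg_eq_trans (ren_eq _ (tu _)) _.
  (* Both sides rename by [fun y => t.1 y + m]: shifting after the renaming is the same as applying
     the lifted renaming after the shift. *)
  apply: neg_eq_trans (ren_ren (r'' := fun y => t.1 y + m) _ _) _ => //.
  apply: neg_eq_sym; apply: ren_ren => y.
  by rewrite /up_ren ltnNge leq_addl /= addnK.
- exact: neg_eq_sym.
- by [].
Qed.

(** Lifting a substitution under a binder shifts its values by a renaming, whence the order of the
    laws: [ren_ren] gives [ren_subst], which together with [subst_ren] gives this one. *)
Lemma subst_subst s1 s2 s : (forall x, neg_eq (s x) (subst_neg s2 (s1 x))) ->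
  (forall P, pos_eq (subst_pos s2 (subst_pos s1 P)) (subst_pos s P)) /\
  (forall N, neg_eq (subst_neg s2 (subst_neg s1 N)) (subst_neg s N)).
Proof.
move=> E; have [m t u tu x|t u x /= tu||hP hN //] := @traversal_eq_full
  (comp_traversal subst_traversal subst_traversal) subst_traversal
  (fun t s => forall x, neg_eq (s x) (subst_neg t.1 (t.2 x))) _ _ (s2, s1) s.
- rewrite /= /up_subst; case: ltnP => mx.
    by rewrite substE /= mx.
  apply: neg_eq_trans (ren_eq _ (tu _)) _.
  apply: neg_eq_trans
    (ren_subst (s' := fun y => ren_neg (addn^~ m) (t.1 y)) _ _) _ => //.
  apply: neg_eq_sym; apply: subst_ren => y.
  by rewrite ltnNge leq_addl /= addnK.
- exact: neg_eq_sym.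
- by [].
Qed.

Lemma ren_as_subst r :
  (forall P, pos_eq (ren_pos r P) (subst_pos (fun x => Var (r x)) P)) /\
  (forall N, neg_eq (ren_neg r N) (subst_neg (fun x => Var (r x)) N)).
Proof.
have [m t u tu x|t u x /= tu||hP hN //] := @traversal_eq_full
  ren_traversal subst_traversal (fun r s => forall x, s x = Var (r x)) _ _
  r (fun x => Var (r x)).
- rewrite /= /up_ren /up_subst; case: ltnP => // mx.
  by rewrite tu ren_Var.
- by rewrite tu.
- by [].
Qed.

Lemma subst_id s :
  (forall P, (forall x, fv_pos x P -> neg_eq (s x) (Var x)) ->
     pos_eq (subst_pos s P) P) /\
  (forall N, (forall x, fv_neg x N -> neg_eq (s x) (Var x)) ->
     neg_eq (subst_neg s N) N).
Proof.
have [m X t u tu x Xx|X t u x tu /tu //|hP hN] :=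
  @traversal_eq subst_traversal id_traversal
    (fun X s _ => forall x, X x -> neg_eq (s x) (Var x)).
- rewrite /= /up_subst; case: ltnP => // mx.
  case: Xx => [|/tu/(ren_eq (addn^~ m))]; first by rewrite ltnNge mx.
  by move/neg_eq_trans; apply; rewrite ren_Var /= subnK.
by split=> [P|N] fvX; [apply: (hP _ s tt _ _ fvX)|apply: (hN _ s tt _ _ fvX)].
Qed.

(** * Reduction *)

Definition conjunct_of P T : Prop := exists i : index P, conjunct i = T.

(** The length is recorded because it is the measure of the induction in [sim_reach]. *)
Inductive reach : nat -> pos A -> predesign A -> Prop :=
| ReachStop P T : conjunct_of P T -> reach 0 P T
| ReachStep n P Q T : step P Q -> reach n Q T -> reach n.+1 P T.

Lemma reachP n P T : reach n P T ->
  match n with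
  | 0 => conjunct_of P T
  | n'.+1 => exists2 Q, step P Q & reach n' Q T
  end.
Proof. by case=> // {}n {}P Q {}T PQ QT; exists Q. Qed.

Lemma stepP P Q : step P Q ->
  exists (R : forall a, pos A) b (Ns : 'I_(ar b) -> neg A),
  conjunct_of P (Cut (Sum R) b Ns) /\ Q = subst_pos (instantiate Ns) (R b).
Proof. by case=> J T i R b Ns Ti; exists R, b, Ns; split=> //; exists i. Qed.

Lemma step_conjunct P (R : forall a, pos A) b Ns :
  conjunct_of P (Cut (Sum R) b Ns) ->
  step P (subst_pos (instantiate Ns) (R b)).
Proof. by case: P => [[[]]|J T [i]] /= Ti; exact: Step Ti. Qed.

Lemma conjunct_of_eq P Q T : pos_eq P Q -> conjunct_of P T ->
  exists2 U, conjunct_of Q U & predesign_eq T U.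
Proof.
move=> /pos_eq_unfold[[[]]|I J T' U TU _ [i <-]].
by have [j TUj] := TU i; exists (U j) => //; exists j.
Qed.

Lemma conjunct_of_subst s P T :
  conjunct_of P T -> conjunct_of (subst_pos s P) (subst_predesign s T).
Proof. by case: P => [[[]]|J U [i <-]]; rewrite substE; exists i. Qed.

Lemma conjunct_of_substP s P T : conjunct_of (subst_pos s P) T ->
  exists2 U, conjunct_of P U & T = subst_predesign s U.
Proof.
case: P => [|J U]; rewrite substE; first by case=> -[].
by case=> i <-; exists (U i) => //; exists i.
Qed.

Lemma instantiate_eq m (Ns Ms : 'I_m -> neg A) :
  (forall k, neg_eq (Ns k) (Ms k)) ->
  forall x, neg_eq (instantiate Ns x) (instantiate Ms x).
Proof. by move=> h x; rewrite /instantiate; case: insub. Qed.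

Lemma step_eq P P' Q : pos_eq P P' -> step P Q ->
  exists2 Q', step P' Q' & pos_eq Q Q'.
Proof.
move=> PP' /stepP[R [b [Ns [/(conjunct_of_eq PP')[U P'U] + ->]]]].
move=> /predesign_relP[M [Ms [EU /neg_eq_unfold/neg_relP[R' EM RR'] NsMs]]].
subst U M; exists (subst_pos (instantiate Ms) (R' b)).
  exact: step_conjunct.
by apply: (subst_eq_fv _ _).1 (RR' b) => x _; exact: instantiate_eq.
Qed.

Lemma instantiate_ren m (Ns : 'I_m -> neg A) N :
  neg_eq (subst_neg (instantiate Ns) (ren_neg (addn^~ m) N)) N.
Proof.
apply: neg_eq_trans (subst_ren (s' := Var) _ _) _.
  by move=> y; rewrite /instantiate insubF ?addnK // ltnNge leq_addl.
exact: (subst_id _).2.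
Qed.

(** The commutation behind the stability of [step] under substitution: both sides are the single
    substitution [t], since instantiation undoes the shift made by [up_subst]. *)
Lemma subst_instantiate s m (Ns : 'I_m -> neg A) P :
  pos_eq (subst_pos s (subst_pos (instantiate Ns) P))
    (subst_pos (instantiate (fun k => subst_neg s (Ns k)))
       (subst_pos (up_subst m s) P)).
Proof.
pose t x := subst_neg s (instantiate Ns x).
apply: pos_eq_trans ((subst_subst (s := t) _).1 _) _ => //.
apply: pos_eq_sym; apply: (subst_subst _).1 => x.
rewrite /t /up_subst /instantiate; case: ltnP => mx.
  by rewrite substE insubT.
rewrite insubF ?substE; last by rewrite ltnNge mx.
exact/neg_eq_sym/instantiate_ren.
Qed.

Lemma step_subst s P Q : step P Q ->
  exists2 Q', step (subst_pos s P) Q' & pos_eq Q' (subst_pos s Q).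
Proof.
move=> /stepP[R [b [Ns [/(conjunct_of_subst s)]]]]; rewrite !substE => PT ->.
eexists; first exact: step_conjunct PT.
exact: pos_eq_sym (subst_instantiate _ _ _).
Qed.

Lemma reach_eq n P P' T : pos_eq P P' -> reach n P T ->
  exists2 T', reach n P' T' & predesign_eq T T'.
Proof.
move=> PP' PT; elim: PT P' PP' => {n P T} [P T PT|n P Q T PQ _ IH] P' PP'.
  by have [U P'U TU] := conjunct_of_eq PP' PT; exists U => //; exact: ReachStop.
have [Q' P'Q' /IH[T' Q'T' TT']] := step_eq PP' PQ.
by exists T' => //; exact: ReachStep P'Q' Q'T'.
Qed.

Lemma reach_subst s n P T : reach n P T ->
  exists2 T', reach n (subst_pos s P) T' & predesign_eq T' (subst_predesign s T).
Proof.
elim=> {n P T} [P T PT|n P Q T PQ _ [T' QT' TT']].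
  by exists (subst_predesign s T) => //; exact/ReachStop/conjunct_of_subst.
have [Q' PQ' /pos_eq_sym Q'Q] := step_subst s PQ.
have [T'' QT'' T'T''] := reach_eq Q'Q QT'.
exists T''; first exact: ReachStep PQ' QT''.
exact: predesign_eq_trans (predesign_eq_sym T'T'') TT'.
Qed.

Lemma steps_refl P : steps P P.
Proof. by left. Qed.

Lemma steps_cons P Q R : step P Q -> steps Q R -> steps P R.
Proof. by right with Q. Qed.

Lemma steps_trans P Q R : steps P Q -> steps Q R -> steps P R.
Proof.
by move=> PQ QR; elim: PQ QR => // P' P1 Q' st _ IH /IH; apply: steps_cons st.
Qed.

Lemma reach_steps n P T : reach n P T ->
  exists2 Q, steps P Q & conjunct_of Q T.
Proof.
elim=> {n P T} [P T PT|n P Q T PQ _ [Q' QQ' Q'T]].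
  by exists P => //; exact: steps_refl.
by exists Q' => //; apply: steps_cons PQ QQ'.
Qed.

Lemma steps_reach P Q T : steps P Q -> conjunct_of Q T ->
  exists n, reach n P T.
Proof.
elim=> {P Q} [P|P P1 Q PP1 _ IH] PT; first by exists 0; exact: ReachStop.
by have [n P1T] := IH PT; exists n.+1; exact: ReachStep PP1 P1T.
Qed.

(** The first step is compulsory: with empty rounds allowed, [diverges_coind_plus] would make every
    design diverge. *)
Definition psteps P Q : Prop := exists2 P1, step P P1 & steps P1 Q.

Lemma reach_psteps n P (R : forall a, pos A) b Ns :
  reach n P (Cut (Sum R) b Ns) ->
  psteps P (subst_pos (instantiate Ns) (R b)).
Proof.
move=> /reach_steps[Q PQ /step_conjunct].
elim: PQ => {P Q} [P PQ|P P1 Q PP1 _ IH /IH[P2 P1P2 P2Q]].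
  by eexists; first exact: PQ; exact: steps_refl.
by exists P1 => //; apply: steps_cons P1P2 P2Q.
Qed.

Lemma steps_eq P P' Q : pos_eq P P' -> steps P Q ->
  exists2 Q', steps P' Q' & pos_eq Q Q'.
Proof.
move=> PP' PQ; elim: PQ P' PP' => {P Q} [P|P P1 Q PP1 _ IH] P' PP'.
  by exists P' => //; exact: steps_refl.
have [P1' P'P1' /IH[Q' P1'Q' QQ']] := step_eq PP' PP1.
by exists Q' => //; apply: steps_cons P'P1' P1'Q'.
Qed.

Lemma steps_subst s P Q : steps P Q ->
  exists2 Q', steps (subst_pos s P) Q' & pos_eq Q' (subst_pos s Q).
Proof.
elim=> {P Q} [P|P P1 Q PP1 _ [Q' P1Q' Q'Q]].
  by exists (subst_pos s P) => //; exact: steps_refl.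
have [P1' PP1' /pos_eq_sym P1P1'] := step_subst s PP1.
have [Q'' P1'Q'' QQ''] := steps_eq P1P1' P1Q'.
exists Q''; first exact: steps_cons PP1' P1'Q''.
exact: pos_eq_trans (pos_eq_sym QQ'') Q'Q.
Qed.

Lemma psteps_eq P P' Q : pos_eq P P' -> psteps P Q ->
  exists2 Q', psteps P' Q' & pos_eq Q Q'.
Proof.
move=> PP' [P1 /(step_eq PP')[P1' P'P1' P1P1'] /(steps_eq P1P1')[Q' P1'Q' QQ']].
by exists Q' => //; exists P1'.
Qed.

Lemma psteps_subst s P Q : psteps P Q ->
  exists2 Q', psteps (subst_pos s P) Q' & pos_eq Q' (subst_pos s Q).
Proof.
move=> [P1 /(step_subst s)[P1' PP1' /pos_eq_sym P1P1'] P1Q].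
have [Q' /(steps_eq P1P1')[Q'' P1'Q'' Q'Q''] Q'Q] := steps_subst s P1Q.
exists Q''; first by exists P1'.
exact: pos_eq_trans (pos_eq_sym Q'Q'') Q'Q.
Qed.

(** * Divergence *)

Lemma diverges_step P Q : step P Q -> diverges Q -> diverges P.
Proof.
move=> PQ [QO|[S [S0 stS]]]; first by left; apply: steps_cons PQ QO.
right; exists (fun n => if n is n'.+1 then S n' else P).
by split=> // -[|n] //; rewrite S0.
Qed.

Lemma diverges_steps P Q : steps P Q -> diverges Q -> diverges P.
Proof. by elim=> // {}P P1 Q' PP1 _ IH /IH; exact: diverges_step PP1. Qed.

Lemma diverges_psteps P Q : psteps P Q -> diverges Q -> diverges P.
Proof.
by case=> P1 PP1 P1Q /(diverges_steps P1Q); exact: diverges_step PP1.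
Qed.

Lemma divergesP P : diverges P ->
  P = Omega \/ exists2 Q, step P Q & diverges Q.
Proof.
case=> [PO|[S [<- stS]]].
  inversion PO as [|P1 Q PP1 P1O]; first by left.
  by right; exists P1 => //; left.
by right; exists (S 1) => //; right; exists (fun n => S n.+1).
Qed.

(** One principle for both kinds of divergence, reaching [Omega] and reducing forever, so that later
    proofs need not separate them. *)
Lemma diverges_coind (S : pos A -> Prop) :
  (forall P, S P -> P = Omega \/ exists2 Q, step P Q & S Q) ->
  forall P, S P -> diverges P.
Proof.
move=> hS P SP.
have /choice[f hf] : forall Q, exists Q', S Q -> Q = Omega \/ step Q Q' /\ S Q'.
  move=> Q; have [/hS[->|[Q' QQ' SQ']]|nSQ] := pselect (S Q).
  - by exists Omega => _; left.
  - by exists Q' => _; right.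
  - by exists Q.
(* Follow the orbit of [P] under the chosen successor [f]: either it meets [Omega] inside [S], or it
   never does and is an infinite reduction. *)
have [[n Sn]|noO] := pselect (exists n, S (iter n f P) /\ iter n f P = Omega).
  elim: n P SP Sn => [|n IH] P SP [Sn En].
    by left; rewrite -En; exact: steps_refl.
  case: (hf _ SP) => [->|[PfP SfP]]; first by left; exact: steps_refl.
  by apply: diverges_step PfP _; apply: IH => //; rewrite -iterSr.
right; exists (fun n => iter n f P); split=> //.
have Sn n : S (iter n f P).
  elim: n => //= n Sn; case: (hf _ Sn) => [En|[]//].
  by case: noO; exists n.
move=> n; case: (hf _ (Sn n)) => [En|[]//].
by case: noO; exists n.
Qed.

Lemma diverges_coind_plus (S : pos A -> Prop) :
  (forall P, S P -> diverges P \/ exists2 Q, psteps P Q & S Q) ->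
  forall P, S P -> diverges P.
Proof.
move=> hS P SP.
(* Adding the designs on the way to [S] turns progress by several steps into progress by one. *)
pose S' P := diverges P \/ exists2 Q, steps P Q & S Q.
apply: (@diverges_coind S'); last by right; exists P => //; exact: steps_refl.
move=> {SP}P [/divergesP[|[Q PQ dQ]]|[Q]]; first by left.
  by right; exists Q => //; left.
move=> PQ SQ; case: PQ SQ => {Q} [|P1 Q PP1 P1Q SQ]; last first.
  by right; exists P1 => //; right; exists Q.
case/hS=> [/divergesP[|[Q PQ dQ]]|[Q [P1 PP1 P1Q] SQ]].
- by left.
- by right; exists Q => //; left.
- by right; exists P1 => //; right; exists Q.
Qed.

Lemma diverges_eq P P' : pos_eq P P' -> diverges P -> diverges P'.
Proof.
move=> PP' dP.
apply: (@diverges_coind (fun P' => exists2 P, pos_eq P P' & diverges P)).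
  move=> {dP PP'}P' {P}[P PP' /divergesP[E|[Q PQ dQ]]].
    by left; case/pos_eq_unfold: PP' E.
  by have [Q' P'Q' QQ'] := step_eq PP' PQ; right; exists Q' => //; exists Q.
by exists P.
Qed.

Lemma diverges_subst s P : diverges P -> diverges (subst_pos s P).
Proof.
move=> dP; apply: (@diverges_coind
  (fun P' => exists2 P, pos_eq (subst_pos s P) P' & diverges P)).
  move=> {dP}P' {P}[P PP' /divergesP[E|[Q PQ dQ]]].
    by left; subst P; move: PP'; rewrite substE => /pos_eq_unfold/pos_relP.
  have [Q1 PQ1 Q1Q] := step_subst s PQ.
  have [Q' P'Q' QQ'] := step_eq PP' PQ1; right; exists Q' => //; exists Q => //.
  exact: pos_eq_trans (pos_eq_sym Q1Q) QQ'.
by exists P.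
Qed.

(** A cut of [P[s]] is either a cut of [P], or a head variable [y] of [P] that becomes a cut because
    [s y] is a sum. *)
Lemma step_substP s P Q : step (subst_pos s P) Q ->
  (exists2 P1, step P P1 & pos_eq Q (subst_pos s P1)) \/
  exists y b (N : 'I_(ar b) -> neg A) (R : forall a, pos A),
    [/\ conjunct_of P (Cut (Var y) b N), s y = Sum R
      & Q = subst_pos (instantiate (fun k => subst_neg s (N k))) (R b)].
Proof.
move=> /stepP[R [b [Ns [/conjunct_of_substP[T PT] ET ->]]]].
rewrite -[subst_pos _ _]/(contract (Cut (Sum R) b Ns)) ET.
case: T PT ET => [[y|R0] a N] PT; rewrite !substE /= => ET.
  right; case sy: (s y) ET => [//|R'] _.
  by exists y, a, N, R'.
left; exists (subst_pos (instantiate N) (R0 a)); first exact: step_conjunct.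
exact/pos_eq_sym/subst_instantiate.
Qed.

(** If no contraction at a substituted head variable leads to divergence, each step that keeps
    [P[s]] diverging lifts to a step of [P], so [P] diverges by itself. *)
Lemma diverges_substP s P : diverges (subst_pos s P) ->
  diverges P \/ exists n y b (N : 'I_(ar b) -> neg A) (R : forall a, pos A),
    [/\ reach n P (Cut (Var y) b N), s y = Sum R
      & diverges (subst_pos (instantiate (fun k => subst_neg s (N k))) (R b))].
Proof.
move=> dP.
pose C P := exists n y b (N : 'I_(ar b) -> neg A) (R : forall a, pos A),
  [/\ reach n P (Cut (Var y) b N), s y = Sum R
    & diverges (subst_pos (instantiate (fun k => subst_neg s (N k))) (R b))].
have [|nC] := pselect (C P); [by right | left].
apply: (@diverges_coind (fun P => diverges (subst_pos s P) /\ ~ C P)) => //.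
move=> {dP nC}P [/divergesP[E|[Q PQ dQ]] nC].
  by left; case: P E {nC} => [//|J T]; rewrite substE.
right; case: (step_substP PQ) => [[P1 PP1 QP1]|[y [b [N [R [PN sy EQ]]]]]].
  exists P1 => //; split; first exact: diverges_eq dQ.
  move=> [n [y [b [N [R [P1N sy dR]]]]]]; apply: nC.
  by exists n.+1, y, b, N, R; split=> //; exact: ReachStep PP1 P1N.
case: nC; exists 0, y, b, N, R; rewrite -EQ; split=> //; exact: ReachStop.
Qed.

Lemma has_head_var_rel (RP : pos A -> pos A -> Prop) T U :
  predesign_rel (neg_rel RP) T U -> has_head_var T = has_head_var U.
Proof. by case=> _ _ a Ns Ms [|]. Qed.

Lemma has_head_var_eq T U : predesign_eq T U -> has_head_var T = has_head_var U.
Proof.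
move=> TU; apply: (@has_head_var_rel (@pos_eq A)).
by apply: predesign_rel_mono TU => N M; exact: neg_eq_unfold.
Qed.

(** In the second case the contraction at [y] costs one step, hence [k + m < n]: both the part
    before it and the part after it are strictly shorter than the whole. *)
Lemma reach_substP s n P T : reach n (subst_pos s P) T -> has_head_var T ->
  (exists T0, [/\ reach n P T0, has_head_var T0
                & predesign_eq T (subst_predesign s T0)]) \/
  exists k m y b (N : 'I_(ar b) -> neg A) (R : forall a, pos A) T',
    [/\ reach k P (Cut (Var y) b N), s y = Sum R,
      reach m (subst_pos (instantiate (fun k => subst_neg s (N k))) (R b)) T',
      predesign_eq T T' & k + m < n].
Proof.
elim: n P T => [|n IH] P T.
  move=> /reachP/conjunct_of_substP[[N a Ns] PU ->].
  rewrite substE => hT; left; exists (Cut N a Ns); rewrite substE.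
  split=> //; first exact: ReachStop.
  by case: N hT {PU}; rewrite //= => R; rewrite substE.
move=> /reachP[Q1 + Q1T] hT.
move=> /step_substP[[P1 PP1 EQ1]|[y [b [N [R [PN sy EQ1]]]]]]; last first.
  right; exists 0, n, y, b, N, R, T; rewrite -EQ1; split=> //.
  exact: ReachStop.
have [T' + TT'] := reach_eq EQ1 Q1T.
rewrite (has_head_var_eq TT') in hT => /IH/(_ hT)[|]{hT}.
  case=> T0 [QT0 hT0 T'T0]; left; exists T0; split=> //.
    exact: ReachStep PP1 QT0.
  exact: predesign_eq_trans TT' T'T0.
move=> [k [m [y [c [N [S [T'' [QN sy RT'' T'T'' km]]]]]]]]; right.
exists k.+1, m, y, c, N, S, T''; split=> //.
  exact: ReachStep PP1 QN.
exact: predesign_eq_trans TT' T'T''.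
Qed.

(** * Associativity of normalization *)

Lemma normal_Omega P : diverges P -> normal_pos P = Omega.
Proof. by move=> dP; rewrite [LHS]pos_unfold /=; case: asboolP. Qed.

Lemma normal_Var x : normal_neg (@Var A x) = Var x.
Proof. by rewrite [LHS]neg_unfold. Qed.

Lemma normal_Sum (P : forall a, pos A) :
  normal_neg (Sum P) = Sum (fun a => normal_pos (P a)).
Proof. by rewrite [LHS]neg_unfold. Qed.

Lemma step_normal P Q : ~ step (normal_pos P) Q.
Proof.
have [dP|nP] := pselect (diverges P).
  by rewrite normal_Omega // => /stepP[R [b [Ns [[[]]]]]].
move=> /stepP[R [b [Ns [/(conjunct_normal _ nP)[_ [_ [x [a [Ms [_ _ E]]]]]] _]]]].
by have := congr1 (@has_head_var A) E.
Qed.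

(* Two designs are related when one is obtained from the other by normalizing
   or unfolding normal forms of some of its subdesigns. Both directions are
   included so that a single argument shows that normalization inside a
   context neither creates nor removes divergence. *)
Inductive sim : pos A -> pos A -> Prop :=
| SimEq P Q : pos_eq P Q -> sim P Q
| SimNormal P : sim P (normal_pos P)
| SimUnnormal P : sim (normal_pos P) P
| SimSubst P P' s s' : sim P P' -> (forall x, neg_rel sim (s x) (s' x)) ->
    sim (subst_pos s P) (subst_pos s' P')
| SimTrans P Q Q' P' : pos_eq P Q -> sim Q Q' -> pos_eq Q' P' -> sim P P'.

Definition neg_sim : neg A -> neg A -> Prop := neg_rel sim.

Lemma neg_sim_eq N M : neg_eq N M -> neg_sim N M.
Proof. by move/neg_eq_unfold; apply: neg_rel_mono => P Q; exact: SimEq. Qed.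

Lemma neg_sim_normal N : neg_sim N (normal_neg N).
Proof.
case: N => [x|P]; first by rewrite normal_Var; exact: VarRel.
by rewrite normal_Sum; apply: SumRel => a; exact: SimNormal.
Qed.

Lemma neg_sim_unnormal N : neg_sim (normal_neg N) N.
Proof.
case: N => [x|P]; first by rewrite normal_Var; exact: VarRel.
by rewrite normal_Sum; apply: SumRel => a; exact: SimUnnormal.
Qed.

Lemma neg_sim_trans N M M' N' :
  neg_eq N M -> neg_sim M M' -> neg_eq M' N' -> neg_sim N N'.
Proof.
move=> /neg_eq_sym/neg_eq_unfold/neg_relP MN MM' /neg_eq_unfold/neg_relP M'N'.
case: MM' MN M'N' => [x -> ->|P Q PQ [P' -> PP'] [Q' -> QQ']].
  exact: VarRel.
by apply: SumRel => a; apply: SimTrans (PQ a) (QQ' a); exact: pos_eq_sym.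
Qed.

Lemma neg_sim_ren r N N' : neg_sim N N' -> neg_sim (ren_neg r N) (ren_neg r N').
Proof.
move=> NN'; pose s x := @Var A (r x).
apply: neg_sim_trans ((ren_as_subst r).2 N) _ (neg_eq_sym ((ren_as_subst r).2 N')).
case: NN' => [x|P P' PP']; rewrite !substE; first exact: VarRel.
apply: SumRel => a; apply: SimSubst => // x.
by apply: neg_sim_eq.
Qed.

Lemma neg_sim_subst s s' N N' : neg_sim N N' ->
  (forall x, neg_sim (s x) (s' x)) -> neg_sim (subst_neg s N) (subst_neg s' N').
Proof.
move=> NN' ss'; case: NN' => [x|P P' PP']; rewrite !substE //.
apply: SumRel => a; apply: SimSubst => // x; rewrite /up_subst.
by case: ltnP => _; [exact: VarRel|exact: neg_sim_ren].
Qed.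

Lemma neg_sim_instantiate m (Ns Ms : 'I_m -> neg A) :
  (forall k, neg_sim (Ns k) (Ms k)) ->
  forall x, neg_sim (instantiate Ns x) (instantiate Ms x).
Proof.
by move=> h x; rewrite /instantiate; case: insub => [//|]; exact: VarRel.
Qed.

Definition predesign_sim : predesign A -> predesign A -> Prop :=
  predesign_rel neg_sim.

Lemma predesign_sim_trans T U U' T' : predesign_eq T U -> predesign_sim U U' ->
  predesign_eq U' T' -> predesign_sim T T'.
Proof.
move=> TU UU' U'T'.
have UT' : predesign_rel (fun N M => exists2 L, neg_sim N L & neg_eq L M) U T'.
  by apply: predesign_rel_trans UU' U'T' => N M L NM ML; exists M.
apply: predesign_rel_trans TU UT' => N M M' NM [L ML LM'].
exact: neg_sim_trans NM ML LM'.
Qed.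

Lemma predesign_sim_subst s s' T T' : predesign_sim T T' ->
  (forall x, neg_sim (s x) (s' x)) ->
  predesign_sim (subst_predesign s T) (subst_predesign s' T').
Proof.
by move=> [N M a Ns Ms NM NsMs] ss'; rewrite !substE; split=> [|k];
  exact: neg_sim_subst.
Qed.

(** The contraction at a substituted head variable is matched on the other side, since [neg_sim]
    preserves sums and the two contracta are related by [SimSubst]. The match takes at least one
    step, which is what the coinduction on divergence needs. *)
Lemma sim_jump s s' n P' y b (Ns Ns' : 'I_(ar b) -> neg A)
    (R : forall a, pos A) :
  reach n P' (Cut (Var y) b Ns') -> (forall k, neg_sim (Ns k) (Ns' k)) ->
  (forall x, neg_sim (s x) (s' x)) -> s y = Sum R ->
  exists2 Q, psteps (subst_pos s' P') Q &
    sim (subst_pos (instantiate (fun k => subst_neg s (Ns k))) (R b)) Q.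
Proof.
move=> P'N NsNs' ss' sy; have := ss' y; rewrite sy => /neg_relP[R' s'y RR'].
have [T P'T /predesign_eq_sym] := reach_subst s' P'N.
rewrite !substE s'y => /predesign_relP[M [Ms [ET + NM]]].
move=> /neg_eq_unfold/neg_relP[R'' EM R'R'']; subst M T.
eexists; first exact: reach_psteps P'T.
apply: SimTrans (pos_eq_refl _) (_ : sim _ (subst_pos
  (instantiate (fun k => subst_neg s' (Ns' k))) (R' b))) _.
  apply: SimSubst => //; apply: neg_sim_instantiate => k.
  exact: neg_sim_subst.
by apply: (subst_eq_fv _ _).1 => // x _; exact: instantiate_eq.
Qed.

(** The escape [diverges P'] is needed because the normal form of a diverging design is [Omega],
    which has no conjuncts. The induction is lexicographic, on a bound for the length on the left
    and then on the derivation of [sim]; the length [n'] on the right is not controlled, because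
    normal forms hide arbitrarily long reductions. *)
Lemma sim_reach n P P' T : sim P P' -> reach n P T -> has_head_var T ->
  diverges P' \/ exists n' T', reach n' P' T' /\ predesign_sim T T'.
Proof.
have [m] := ubnP n; elim: m n P P' T => // m IHm n P P' T /ltnSE nm PP'.
elim: PP' n nm T =>
  {P P'} [P P' PP'|P|P|P P' s s' PP' IH ss'|P Q Q' P' PQ _ IH Q'P']
  n nm T PT hT.
- right; have [T' P'T' TT'] := reach_eq PP' PT; exists n, T'; split=> //.
  by apply: predesign_rel_mono TT'; exact: neg_sim_eq.
- have [dP|nP] := pselect (diverges P).
    by left; rewrite normal_Omega //; left; exact: steps_refl.
  right; have [Q PQ [i Ei]] := reach_steps PT.
  case: T hT Ei {PT} => [[x|R] a Ns] // _ Ei.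
  exists 0, (Cut (Var x) a (fun k => normal_neg (Ns k))); split.
    apply: ReachStop; apply/(conjunct_normal _ nP).
    by exists Q, i, x, a, Ns.
  by split=> [|k]; [exact: VarRel|exact: neg_sim_normal].
- have [|nP] := pselect (diverges P); first by left.
  right; case: n PT {nm} => [|n] /reachP; last by case=> Q /step_normal.
  move=> /(conjunct_normal _ nP)[Q [i [x [a [Ns [PQ Ei ET]]]]]].
  have [n PT] := steps_reach PQ (ex_intro _ i Ei).
  exists n, (Cut (Var x) a Ns); split=> //; rewrite ET.
  by split=> [|k]; [exact: VarRel|exact: neg_sim_unnormal].
- case: (reach_substP PT hT) => [[T0 [PT0 hT0 TT0]]|].
    have [dP'|[n' [T' [P'T' T0T']]]] := IH _ nm _ PT0 hT0.
      by left; exact: diverges_subst.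
    right; have [T'' P'T'' T''T'] := reach_subst s' P'T'.
    exists n', T''; split=> //.
    apply: predesign_sim_trans TT0 _ (predesign_eq_sym T''T').
    exact: predesign_sim_subst.
  move=> [k [m' [y [b [N [R [T' [PN sy RT' TT' km]]]]]]]].
  have kn : k <= m.
    by apply: leq_trans nm; apply: leq_trans (ltnW km); exact: leq_addr.
  have [dP'|[n' [U [P'U]]]] := IH _ kn _ PN erefl.
    by left; exact: diverges_subst.
  move=> UT; case/predesign_relP: UT P'U => _ [N' [-> /neg_relP -> NN']] P'U.
  have [Q P'Q RQ] := sim_jump P'U NN' ss' sy.
  have m'm : m' < m.
    by apply: leq_trans nm; apply: leq_ltn_trans km; exact: leq_addl.
  have hT' : has_head_var T' by rewrite -(has_head_var_eq TT').
  (* [RQ] is a new derivation, not a part of the current one; the outer induction applies because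
     the remaining reduction is shorter. *)
  have [dQ|[n'' [T'' [QT'' T'T'']]]] := IHm _ _ _ _ m'm RQ RT' hT'.
    by left; exact: diverges_psteps P'Q dQ.
  right; have [Q' QQ' Q'T''] := reach_steps QT''.
  case: P'Q => P1 PP1 P1Q.
  have [n1 P1T''] := steps_reach (steps_cons PP1 (steps_trans P1Q QQ')) Q'T''.
  exists n1, T''; split=> //.
  exact: predesign_sim_trans TT' T'T'' (predesign_eq_refl _).
- have [U QU TU] := reach_eq PQ PT.
  rewrite (has_head_var_eq TU) in hT.
  have [dQ'|[n' [U' [Q'U' UU']]]] := IH _ nm _ QU hT.
    by left; exact: diverges_eq dQ'.
  right; have [T' P'T' U'T'] := reach_eq Q'P' Q'U'.
  by exists n', T'; split=> //; exact: predesign_sim_trans TU UU' U'T'.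
Qed.

(** One round of the coinduction of [sim_diverges], by induction on [sim]. Progress originates in
    [SimSubst], from a contraction at a substituted head variable. For [SimUnnormal], a normal form
    has no cut, so it diverges only if it is [Omega]. *)
Lemma sim_progress P P' : sim P P' -> diverges P ->
  diverges P' \/ exists Q Q', [/\ psteps P' Q', sim Q Q' & diverges Q].
Proof.
elim=> {P P'} [P P' PP'|P|P|P P' s s' PP' IH ss'|P Q Q' P' PQ _ IH Q'P'] dP.
- by left; exact: diverges_eq dP.
- by left; rewrite normal_Omega //; left; exact: steps_refl.
- left; have [//|nP] := pselect (diverges P).
  case: (divergesP dP) => [|[Q /step_normal//]].
  by rewrite normal_posE.
- have [dP0|[n [y [b [N [R [PN sy dR]]]]]]] := diverges_substP dP.
    have [dP'|[Q [Q' [P'Q' QQ' dQ]]]] := IH dP0.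
      by left; exact: diverges_subst.
    right; have [Q'' P'Q'' Q''Q'] := psteps_subst s' P'Q'.
    exists (subst_pos s Q), Q''; split=> //; last exact: diverges_subst.
    by apply: SimTrans (pos_eq_refl _) _ (pos_eq_sym Q''Q'); exact: SimSubst.
  have [dP'|[n' [U [P'U]]]] := sim_reach PP' PN erefl.
    by left; exact: diverges_subst.
  move=> UT; case/predesign_relP: UT P'U => _ [N' [-> /neg_relP -> NN']] P'U.
  have [Q P'Q RQ] := sim_jump P'U NN' ss' sy.
  by right; do 2 eexists; split; [exact: P'Q|exact: RQ|].
- have [dQ'|[R [R' [Q'R' RR' dR]]]] := IH (diverges_eq PQ dP).
    by left; exact: diverges_eq dQ'.
  right; have [R'' P'R'' R'R''] := psteps_eq Q'P' Q'R'.
  by exists R, R''; split=> //; exact: SimTrans (pos_eq_refl _) RR' R'R''.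
Qed.

Lemma sim_diverges P P' : sim P P' -> diverges P -> diverges P'.
Proof.
move=> PP' dP.
apply: (@diverges_coind_plus (fun P' => exists2 P, sim P P' & diverges P)).
  move=> {dP PP'}P' {P}[P PP' /(sim_progress PP')[|[Q [Q' [P'Q' QQ' dQ]]]]].
    by left.
  by right; exists Q' => //; exists Q.
by exists P.
Qed.

Definition good P : Prop :=
  ~ diverges P /\ forall n T, reach n P T -> ~ has_head_var T.

Lemma normal_daimon P : pos_eq (normal_pos P) (daimon A) <-> good P.
Proof.
split.
  move=> Pd; have nP : ~ diverges P.
    by move=> dP; move: Pd; rewrite normal_Omega // => /pos_eq_unfold/pos_relP.
  split=> // n T /reach_steps[Q PQ [i Ei]].
  case: T Ei => [[x|//] a Ns] Ei _.
  have PT : conjunct_of (normal_pos P)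
      (Cut (Var x) a (fun k => normal_neg (Ns k))).
    by apply/(conjunct_normal _ nP); exists Q, i, x, a, Ns.
  by have [U [[]]] := conjunct_of_eq Pd PT.
case=> nP noP; apply: pos_eq_fold; rewrite normal_posE //.
apply: ConjRel => [[r hr]|[]]; exfalso.
have [Q [i [PQ Ei]]] := run_steps r.
have [n PT] := steps_reach PQ (ex_intro _ i Ei).
exact: noP PT hr.
Qed.

(** One direction is enough: [SimNormal] and [SimUnnormal] make it usable both to and from normal
    forms. *)
Lemma sim_good P P' : sim P P' -> good P' -> good P.
Proof.
move=> PP' [nP' noP']; split=> [/(sim_diverges PP')//|n T PT hT].
have [//|[n' [T' [/noP' + TT']]]] := sim_reach PP' PT hT.
by rewrite -(has_head_var_rel TT').
Qed.

Lemma good_eq P P' : pos_eq P P' -> good P' -> good P.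
Proof. by move/SimEq/sim_good. Qed.

(** * Free variables *)

Lemma fv_negP x N : fv_neg x N ->
  match N with
  | Var y => x = y
  | Sum P => exists a, fv_pos (x + ar a) (P a)
  end.
Proof. by case=> // P a; exists a. Qed.

Lemma fv_predesignP x T : fv_predesign x T ->
  let: Cut N a Ns := T in fv_neg x N \/ exists k, fv_neg x (Ns k).
Proof. by case=> [N a Ns|N a Ns k] fx; [left|right; exists k]. Qed.

Lemma fv_posP x P : fv_pos x P ->
  exists2 T, conjunct_of P T & fv_predesign x T.
Proof. by case=> J T i fx; exists (T i) => //; exists i. Qed.

Lemma fv_conjunct x P T : conjunct_of P T -> fv_predesign x T -> fv_pos x P.
Proof. by case: P => [[[]]|J U [i <-]]; exact: FvConj. Qed.

Scheme fv_pos_mut := Minimality for fv_pos Sort Prop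
with fv_predesign_mut := Minimality for fv_predesign Sort Prop
with fv_neg_mut := Minimality for fv_neg Sort Prop.
Combined Scheme fv_mutind from fv_pos_mut, fv_predesign_mut, fv_neg_mut.

(** Stating that an argument recurs at some index [k'] avoids transporting [k] along the equality of
    the names. *)
Lemma Cut_arg N a (Ns : 'I_(ar a) -> neg A) M b (Ms : 'I_(ar b) -> neg A) :
  Cut N a Ns = Cut M b Ms -> forall k, exists k', Ns k = Ms k'.
Proof.
pose S T := let: Cut _ _ Ms := T in forall k, exists k', Ns k = Ms k'.
by move=> E; rewrite -[forall k, _]/(S (Cut M b Ms)) -E => k; exists k.
Qed.

Section FvTraversal.
Variable F : traversal.
Hypothesis fv_up : forall m t x y, fv_neg (x + m) (@on_var F (up m t) y) ->
  m <= y /\ fv_neg x (on_var t (y - m)).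

(** The induction is on the occurrence of [x] in the result, hence the equations [P' = tr_pos t P];
    [fv_up] brings the occurrence back out of a binder. *)
Lemma fv_traversal x :
  (forall P', fv_pos x P' -> forall t P, P' = tr_pos t P ->
     exists2 y, fv_pos y P & fv_neg x (@on_var F t y)) /\
  (forall T', fv_predesign x T' -> forall t T, T' = tr_predesign t T ->
     exists2 y, fv_predesign y T & fv_neg x (@on_var F t y)) /\
  (forall N', fv_neg x N' -> forall t N, N' = tr_neg t N ->
     exists2 y, fv_neg y N & fv_neg x (@on_var F t y)).
Proof.
move: x; apply: fv_mutind.
- move=> x J T i _ IH t [|J' T']; rewrite ?tr_Omega ?tr_Conj // => E.
  have [i' Ei'] : conjunct_of (Conj J' (fun i => tr_predesign t (T' i))) (T i).
    by rewrite -E; exists i.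
  have [y fy fx] := IH t (T' i') (esym Ei').
  by exists y => //; exact: FvConj fy.
- move=> x N a Ns _ IH t [N' a' Ns']; rewrite tr_Cut => E.
  have [|y fy fx] := IH t N'.
    by have := congr1 (fun T => let: Cut N a Ns := T in N) E.
  by exists y => //; exact: FvHead.
- move=> x N a Ns k _ IH t [N' a' Ns']; rewrite tr_Cut => E.
  have [k' Ek'] := Cut_arg E k.
  have [y fy fx] := IH t (Ns' k') Ek'.
  by exists y => //; exact: FvArg fy.
- move=> x t [y|P]; rewrite ?tr_Var ?tr_Sum // => E.
  by exists y; [exact: FvVar|rewrite -E; exact: FvVar].
- move=> x P a fP IH t [y|P']; rewrite ?tr_Var ?tr_Sum => E.
    by exists y; [exact: FvVar|rewrite -E; exact: FvSum fP].
  case: E => E; have [|y fy fx] := IH (up (ar a) t) (P' a); first by rewrite E.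
  have [ay fx'] := fv_up fx; exists (y - ar a) => //.
  by apply: (@FvSum _ _ _ a); rewrite subnK.
Qed.
End FvTraversal.

Lemma fv_ren r x N : fv_neg x (ren_neg r N) ->
  exists2 y, fv_neg y N & x = r y.
Proof.
have [|_ [_ h] fx] := @fv_traversal ren_traversal _ x.
  move=> m t {}x y /=; rewrite /up_ren; case: ltnP => my /fv_negP E.
    by move: my; rewrite -E ltnNge leq_addl.
  by split=> //; move/addIn: E => ->; exact: FvVar.
by have [y fy /fv_negP xy] := h _ fx r N erefl; exists y.
Qed.

Lemma fv_subst s :
  (forall x P, fv_pos x (subst_pos s P) ->
     exists2 y, fv_pos y P & fv_neg x (s y)) /\
  (forall x N, fv_neg x (subst_neg s N) ->
     exists2 y, fv_neg y N & fv_neg x (s y)).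
Proof.
have h m t x y :
    fv_neg (x + m) (@on_var subst_traversal (@up subst_traversal m t) y) ->
    m <= y /\ fv_neg x (@on_var subst_traversal t (y - m)).
  rewrite /= /up_subst; case: ltnP => my.
    by move=> /fv_negP E; move: my; rewrite -E ltnNge leq_addl.
  by move/fv_ren=> [z fz /addIn ->].
split=> [x P|x N] fx.
- exact: (fv_traversal h x).1 _ fx _ _ erefl.
- exact: (fv_traversal h x).2.2 _ fx _ _ erefl.
Qed.

Lemma fv_step x P Q : step P Q -> fv_pos x Q -> fv_pos x P.
Proof.
move=> /stepP[R [b [Ns [PT ->]]]] /(fv_subst _).1[y fy fx].
apply: (fv_conjunct PT); move: fx; rewrite /instantiate.
case: insubP => [k _ _|]; first exact: FvArg.
rewrite -leqNgt => my /fv_negP xy; apply/FvHead/(@FvSum _ _ _ b).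
by rewrite xy subnK.
Qed.

Lemma fv_steps x P Q : steps P Q -> fv_pos x Q -> fv_pos x P.
Proof. by elim=> // {}P P1 Q' PP1 _ IH /IH; exact: fv_step. Qed.

Lemma fv_normal x N : fv_neg x (normal_neg N) -> fv_neg x N.
Proof.
suff [_ [_ h]] :
  (forall P', fv_pos x P' -> forall P, P' = normal_pos P -> fv_pos x P) /\
  (forall T', fv_predesign x T' -> forall M a Ns,
     T' = Cut M a (fun k => normal_neg (Ns k)) -> fv_predesign x (Cut M a Ns)) /\
  (forall N', fv_neg x N' -> forall N, N' = normal_neg N -> fv_neg x N).
  by move=> fx; exact: h fx _ erefl.
move: x {N}; apply: fv_mutind.
- move=> x J T i _ IH P E.
    have PT : conjunct_of (normal_pos P) (T i) by rewrite -E; exists i.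
    have nP : ~ diverges P by move=> /normal_Omega EO; rewrite EO in E.
    have [Q [j [y [a [Ns [PQ Ej ET]]]]]] := (conjunct_normal _ nP).1 PT.
    by apply: (fv_steps PQ); apply: fv_conjunct (IH _ _ _ ET); exists j.
- move=> x N a Ns fN _ M b Ms E; apply: FvHead.
    by have <- := congr1 (fun T => let: Cut N a Ns := T in N) E.
- move=> x N a Ns k _ IH M b Ms E; have [k' Ek'] := Cut_arg E k.
    exact: FvArg (IH _ Ek').
- move=> x [y|P]; rewrite ?normal_Var ?normal_Sum // => -[->]; exact: FvVar.
- move=> x P a _ IH [y|P']; rewrite ?normal_Var ?normal_Sum // => -[E].
    by apply: (@FvSum _ _ _ a); apply: IH; rewrite E.
Qed.

(** * Normal forms of identity-free designs *)

Definition is_sum N : bool := if N is Sum _ then true else false.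

(** One layer of the predicate, with [S] standing for the recursive occurrence; [idfree] takes the
    union of all [S] stable under it. *)
Definition idfree_neg_upto (S : pos A -> Prop) N : Prop :=
  if N is Sum P then forall a, S (P a) else True.

Definition idfree_predesign_upto (S : pos A -> Prop) T : Prop :=
  let: Cut N a Ns := T in idfree_neg_upto S N /\
    forall k, is_sum (Ns k) /\ idfree_neg_upto S (Ns k).

(* No argument is a variable: this makes normal forms standard, and is preserved
   under reduction. The predicate is the greatest fixpoint. *)
Definition idfree P : Prop := exists2 S : pos A -> Prop, S P &
  forall P T, S P -> conjunct_of P T -> idfree_predesign_upto S T.

Definition idfree_neg : neg A -> Prop := idfree_neg_upto idfree.

Lemma idfree_neg_mono (S S' : pos A -> Prop) N : (forall P, S P -> S' P) ->
  idfree_neg_upto S N -> idfree_neg_upto S' N.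
Proof. by move=> SS'; case: N => //= P h a; exact: SS'. Qed.

Lemma idfree_predesign_mono (S S' : pos A -> Prop) T :
  (forall P, S P -> S' P) ->
  idfree_predesign_upto S T -> idfree_predesign_upto S' T.
Proof.
move=> SS'; case: T => N a Ns /= [hN hNs]; split=> [|k].
  exact: idfree_neg_mono hN.
by have [h1 h2] := hNs k; split=> //; exact: idfree_neg_mono h2.
Qed.

Lemma idfreeP P T : idfree P -> conjunct_of P T -> idfree_predesign_upto idfree T.
Proof.
by move=> [S SP hS] PT; apply: idfree_predesign_mono (hS _ _ SP PT) => Q; exists S.
Qed.

Section IdfreeTraversal.
Variables (F : traversal) (G : param F -> Prop).
Hypothesis G_up : forall m t, G t -> G (up m t).
Hypothesis G_var : forall t x, G t -> idfree_neg (on_var t x).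

Lemma idfree_traversal t :
  G t -> (forall P, idfree P -> idfree (tr_pos t P)) /\
         (forall N, idfree_neg N -> idfree_neg (tr_neg t N)).
Proof.
pose S Q := idfree Q \/ exists t P, [/\ G t, idfree P & Q = tr_pos t P].
have hS Q T : S Q -> conjunct_of Q T -> idfree_predesign_upto S T.
  have idS P : idfree P -> S P by left.
  case=> [idQ QT|[u [P [Gu idP ->]]]].
    by apply: idfree_predesign_mono (idfreeP idQ QT).
  have hN N : idfree_neg N -> idfree_neg_upto S (tr_neg u N).
    case: N => [x|R] idR; rewrite ?tr_Var ?tr_Sum.
      by apply: idfree_neg_mono (G_var _ Gu).
    by move=> a; right; exists (up (ar a) u), (R a); split=> //; exact: G_up.
  case: P idP => [|J U] idP; rewrite ?tr_Omega ?tr_Conj; first by case=> -[].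
  case=> i /= <-; have /(idfreeP idP) : conjunct_of (Conj J U) (U i) by exists i.
  case: (U i) => N a Ns [idN idNs]; rewrite tr_Cut; split=> [|k]; first exact: hN.
  have [sk idk] := idNs k; split; last exact: hN.
  by case: (Ns k) sk => // R _; rewrite tr_Sum.
have SP Q : S Q -> idfree Q by exists S.
move=> Gt; have h P : idfree P -> idfree (tr_pos t P).
  by move=> idP; apply: SP; right; exists t, P.
split=> // -[x|P] idP; rewrite ?tr_Var ?tr_Sum; first exact: G_var.
by move=> a; apply: SP; right; exists (up (ar a) t), (P a); split=> //; exact: G_up.
Qed.

End IdfreeTraversal.

Lemma idfree_subst s : (forall x, idfree_neg (s x)) ->
  (forall P, idfree P -> idfree (subst_pos s P)) /\
  (forall N, idfree_neg N -> idfree_neg (subst_neg s N)).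
Proof.
apply: (@idfree_traversal subst_traversal (fun s => forall x, idfree_neg (s x))).
  move=> m {}s ids x /=; rewrite /up_subst; case: ltnP => // _.
  by apply: (@idfree_traversal ren_traversal xpredT _ _ _ _).2.
by [].
Qed.

Lemma idfree_step P Q : step P Q -> idfree P -> idfree Q.
Proof.
move=> /stepP[R [b [Ns [PT ->]]]] /idfreeP/(_ PT)[idR idNs].
apply: (idfree_subst _).1; last exact: idR.
by move=> x; rewrite /instantiate; case: insub => [k|//]; exact: (idNs k).2.
Qed.

Lemma idfree_steps P Q : steps P Q -> idfree P -> idfree Q.
Proof. by elim=> // {}P P1 Q' PP1 _ IH /(idfree_step PP1). Qed.

(** The guarded [cofix] is done once here, so that standardness of normal forms reduces to an
    ordinary invariant. *)
Lemma std_coind (S : pos A -> Prop) :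
  (forall P T, S P -> conjunct_of P T ->
     exists x a (Ns : 'I_(ar a) -> neg A), T = Cut (Var x) a Ns /\
       forall k, exists2 R : forall b, pos A, Ns k = Sum R & forall b, S (R b)) ->
  forall P, S P -> std_pos P.
Proof.
move=> hS; cofix h => -[|J T] SP; constructor=> i.
case: (hS _ (T i) SP (ex_intro _ i erefl)) => x [a [Ns [-> hNs]]].
by constructor=> k; case: (hNs k) => R -> SR; constructor=> b; apply: h.
Qed.

(** Conjuncts of a normal form have a head variable by construction; their arguments are sums
    because they come from a reduct, which is still [idfree]. *)
Lemma std_normal N : is_sum N -> idfree_neg N -> std_neg (normal_neg N).
Proof.
case: N => // P _ idP; rewrite normal_Sum; constructor=> a.
apply: (@std_coind (fun Q => exists2 P, idfree P & Q = normal_pos P)); last first.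
  by exists (P a).
move=> {a P idP}_ T [P idP ->] PT.
have nP : ~ diverges P.
  by move=> /normal_Omega EO; move: PT; rewrite EO => -[[]].
have [Q [j [x [a [Ns [PQ Ej ->]]]]]] := (conjunct_normal _ nP).1 PT.
exists x, a, (fun k => normal_neg (Ns k)); split=> // k.
have QT : conjunct_of Q (Cut (Var x) a Ns) by exists j.
have [_ /(_ k)[]] := idfreeP (idfree_steps PQ idP) QT.
case: (Ns k) => // R _ idR; exists (fun b => normal_pos (R b)).
  by rewrite normal_Sum.
by move=> b; exists (R b).
Qed.

Lemma std_negP N : std_neg N -> exists2 P : forall a, pos A,
  N = Sum P & forall a, std_pos (P a).
Proof. by case=> P; exists P. Qed.

Lemma std_idfree P : std_pos P -> idfree P.
Proof.
move=> stP; exists (@std_pos A) => // {stP}P T [[[]]|J U stU [i <-]] /=.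
case: (stU i) => x a Ns stNs; split=> // k.
by case/std_negP: (stNs k) => R -> stR.
Qed.

Lemma std_idfree_neg N : std_neg N -> is_sum N /\ idfree_neg N.
Proof. by case/std_negP => P -> stP; split=> // a; exact: std_idfree. Qed.

Lemma atomic_normal N : is_sum N -> idfree_neg N -> (forall x, ~ fv_neg x N) ->
  atomic_neg (normal_neg N).
Proof.
move=> sN idN cN; split; first exact: std_normal.
by move=> x /fv_normal; exact: cN.
Qed.

(** * Behaviours *)

Lemma orthogonalP P N : orthogonal P N <-> good (plug P N).
Proof. exact: normal_daimon. Qed.

(** Triple orthogonality is single orthogonality; atomicity of [Y] puts it inside its biorthogonal,
    whose elements are atomic by definition. *)
Lemma orth_neg_biorth (Y : set (neg A)) : (forall N, Y N -> atomic_neg N) ->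
  orth_neg (orth_pos (orth_neg Y)) = orth_neg Y.
Proof.
move=> atY; apply/seteqP; split=> P [atP hP]; split=> // N.
- by move=> YN; apply: hP; split=> [|Q [_ /(_ N YN)]]; first exact: atY.
- by case=> _; apply.
Qed.

Lemma orth_pos_biorth (X : set (pos A)) : (forall P, X P -> atomic_pos P) ->
  orth_pos (orth_neg (orth_pos X)) = orth_pos X.
Proof.
move=> atX; apply/seteqP; split=> N [atN hN]; split=> // P.
- by move=> XP; apply: hN; split=> [|M [_ /(_ P XP)]]; first exact: atX.
- by case=> _; apply.
Qed.

Lemma logical_pos_behaviour (X : set (pos A)) : logical_pos X -> pos_behaviour X.
Proof. by case=> al Ns _; apply: orth_neg_biorth => N []. Qed.

Lemma logical_neg_behaviour (X : set (neg A)) : logical_neg X -> neg_behaviour X.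
Proof. by case=> al Ps _; apply: orth_pos_biorth => P []. Qed.

Lemma logical_context_behaviours (G : context A) :
  logical_context G -> pos_context G.
Proof. by case=> uG lG; split=> // x X /lG; exact: logical_pos_behaviour. Qed.

Lemma context_varsP (G : context A) x :
  x \in context_vars G <-> exists X, In (x, X) G.
Proof.
elim: G => [|[y Y] G IH] /=; first by split=> // -[].
rewrite inE; split=> [/orP[/eqP->|/IH[X]]|[X [[-> _]|GX]]].
- by exists Y; left.
- by exists X; right.
- by rewrite eqxx.
- by apply/orP; right; apply/IH; exists X.
Qed.

Lemma realizes_atomic (G : context A) K x :
  realizes G K -> x \in context_vars G -> atomic_neg (K x).
Proof. by move=> [h _] /context_varsP[X /h[]]. Qed.

Lemma realizes_idfree (G : context A) K x : realizes G K -> idfree_neg (K x).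
Proof.
move=> rK; have [/(realizes_atomic rK)[/std_idfree_neg[]]//|xG] :=
  boolP (x \in context_vars G).
by rewrite (rK.2 _ xG).
Qed.

Lemma normal_realizes_atomic (G : context A) K N : realizes G K -> std_neg N ->
  (forall x, fv_neg x N -> x \in context_vars G) ->
  atomic_neg (normal_neg (subst_neg K N)).
Proof.
move=> rK /std_idfree_neg[sN idN] fvN; apply: atomic_normal.
- by case: N sN {idN fvN} => // P _; rewrite substE.
- by apply: (idfree_subst _).2 idN => x; exact: realizes_idfree rK.
- by move=> x /(fv_subst _).2[y /fvN/(realizes_atomic rK)[_ cK] /cK].
Qed.

(** * Designs with a single conjunct *)

Lemma single_eq T U : predesign_eq T U -> pos_eq (single T) (single U).
Proof.
by move=> TU; apply: pos_eq_fold; apply: ConjRel => _; exists tt.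
Qed.

Lemma subst_single s T : subst_pos s (single T) = single (subst_predesign s T).
Proof. by rewrite /single substE. Qed.

(** [sim] has no constructor for cuts, so a cut is written as a substitution instance of the generic
    one, with head variable [ar a] and arguments the variables below [ar a]; then [SimSubst]
    applies. *)
Lemma sim_single N M a (Ns Ms : 'I_(ar a) -> neg A) : neg_sim N M ->
  (forall k, neg_sim (Ns k) (Ms k)) ->
  sim (single (Cut N a Ns)) (single (Cut M a Ms)).
Proof.
move=> NM NsMs.
pose s L (Ls : 'I_(ar a) -> neg A) x := if insub x is Some k then Ls k else L.
have E L Ls : pos_eq (single (Cut L a Ls)) (subst_pos (s L Ls)
    (single (Cut (Var (ar a)) a (fun k => Var k)))).
  rewrite subst_single !substE; apply: single_eq; split=> [|k].
    by rewrite /s insubF ?ltnn.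
  by rewrite substE /s valK.
apply: SimTrans (E N Ns) _ (pos_eq_sym (E M Ms)).
apply: SimSubst => [|x]; first exact: SimEq.
by rewrite /s; case: insub.
Qed.

(** The only conjunct is a cut, so there is no head variable yet and every reduction begins with
    this contraction. In the proof, [contract] recovers the reduct from the predesign without
    dependent inversion. *)
Lemma good_cut (R : forall a, pos A) b (Ns : 'I_(ar b) -> neg A) :
  good (subst_pos (instantiate Ns) (R b)) -> good (single (Cut (Sum R) b Ns)).
Proof.
move=> [nR noR].
have stE Q : step (single (Cut (Sum R) b Ns)) Q ->
    Q = subst_pos (instantiate Ns) (R b).
  move=> /stepP[R' [b' [Ns' [[i E] ->]]]].
  by rewrite -[LHS]/(contract (Cut (Sum R') b' Ns')) -E.
split=> [/divergesP[//|[Q /stE -> //]]|[|n] T /reachP].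
- by case=> i <-.
- by case=> Q /stE -> /noR.
Qed.

Lemma plug_single N a (Ns : 'I_(ar a) -> neg A) :
  (forall k x, ~ fv_neg x (Ns k)) ->
  pos_eq (plug (single (Cut (Var x0) a Ns)) N) (single (Cut N a Ns)).
Proof.
move=> cNs; rewrite /plug subst_single !substE eqxx.
apply: single_eq; split=> // k.
by apply: (subst_id _).2 => x /cNs.
Qed.

(** * The rules *)

Lemma pos_rule_sound P (G : context A) z (al : connective A)
    (Ns : 'I_(arity al) -> set (neg A)) (c : action A (arity al))
    (M : 'I_(ar (act_name c)) -> neg A) :
  sequent (PosJ P G) -> In (z, pos_connective Ns) G -> In c (actions al) ->
  pos_eq P (single (Cut (Var z) (act_name c) M)) ->
  (forall k, models (NegJ (M k) G (Ns (act_vars k)))) ->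
  models (PosJ P G).
Proof.
move=> [[stP _] lG fvP] Gz al_c EP hM; split=> //.
  exact: logical_context_behaviours.
move=> K rK; apply/normal_daimon.
pose M' k := normal_neg (subst_neg K (M k)).
have NM' k : Ns (act_vars k) (M' k).
  have [[_ bN] stM fvM gM] := hM k; rewrite -bN.
  split=> [|Q NQ]; first exact: normal_realizes_atomic rK stM fvM.
  apply/orthogonalP; apply: sim_good ((normal_daimon _).1 (gM K Q rK NQ)).
  apply: SimSubst => [|x]; first exact: SimEq.
  by case: ifP => _; [exact: neg_sim_unnormal|exact: VarRel].
have atM' k : atomic_neg (M' k).
  have [_ stM fvM _] := hM k; exact: normal_realizes_atomic rK stM fvM.
(* A generator of the behaviour at [z], hence a design against which [K z] is known to behave
   well. *)
pose P' := single (Cut (Var x0) (act_name c) M').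
have P'N : pos_connective Ns P'.
  split=> [|N [_]]; last by apply; exists c => //; exists M'.
  split=> [|x /fv_posP[_ [_ <-] /fv_predesignP[/fv_negP//|[k]]]].
    split=> //; constructor=> _; constructor=> k; exact: (atM' k).1.
  by case/(atM' k).2.
have [atKz /(_ _ P'N)/orthogonalP] := rK.1 _ _ Gz.
apply: sim_good.
(* [P[K]] is the cut of [K z] with the arguments [M k] closed by [K]; normalizing these arguments
   gives [P'] with [K z] plugged in. *)
apply: (@SimTrans _ (single (Cut (K z) (act_name c) (fun k => subst_neg K (M k))))
  (single (Cut (K z) (act_name c) M'))).
- apply: pos_eq_trans ((subst_eq_fv _ _).1 _ _ _ EP) _ => //.
  by rewrite subst_single !substE.
- by apply: sim_single => [|k]; [exact: neg_sim_eq|exact: neg_sim_normal].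
- by apply/pos_eq_sym/plug_single => k; exact: (atM' k).2.
Qed.

Lemma extend_contextP (G : context A) n (c : action A n)
    (Ps : 'I_n -> set (pos A)) x X : In (x, X) (extend_context G c Ps) ->
  (ar (act_name c) <= x /\ In (x - ar (act_name c), X) G) \/
  exists2 k : 'I_(ar (act_name c)), x = k & X = Ps (act_vars k).
Proof.
rewrite /extend_context => /(in_app_or _ _ _)[|] /(in_map_iff _ _ _)[].
- by case=> y Y [[<- <-] GY]; left; rewrite leq_addl addnK.
- by move=> k [[<- <-] _]; right; exists k.
Qed.

Lemma neg_rule_sound (P : forall a, pos A) (G : context A) (al : connective A)
    (Ps : 'I_(arity al) -> set (pos A)) :
  sequent (NegJ (Sum P) G (neg_connective Ps)) ->
  (forall c, In c (actions al) ->
     models (PosJ (P (act_name c)) (extend_context G c Ps))) ->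
  models (NegJ (Sum P) G (neg_connective Ps)).
Proof.
move=> [[stP _] lG lN fvP] hP; split=> //.
  by split; [exact: logical_context_behaviours|exact: logical_neg_behaviour].
move=> K Q rK NQ; apply/normal_daimon.
set N := subst_neg K (Sum P).
have atN' : atomic_neg (normal_neg N) by exact: normal_realizes_atomic rK stP fvP.
suff NN' : neg_connective Ps (normal_neg N).
  apply: sim_good ((orthogonalP _ _).1 (NQ.2 _ NN')).
  apply: SimSubst => [|x]; first exact: SimEq.
  by case: ifP => _; [exact: neg_sim_normal|exact: VarRel].
(* A design in the biorthogonal of the generators is orthogonal to all that is orthogonal to them,
   so it suffices to test [normal_neg N] on a generator [P1]. *)
split=> // P1 [_]; apply; split=> // {P1}P1 [c al_c [L hL EP1]].
have cL k x : ~ fv_neg x (L k) by case: (hL k) => -[_ +] _; apply.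
apply/orthogonalP.
(* The cut is studied with [N] itself, whose contraction exposes the premise; normalizing the head
   afterwards is harmless by [sim_good]. *)
have : good (single (Cut N (act_name c) L)).
  rewrite /N substE; apply: good_cut.
  have [_ _ fvPc] := hP c al_c; set G' := extend_context _ _ _.
  (* The bound variables receive the arguments [L], the shifted variables of [G] what [K] gives
     them; off the context [realizes] demands the identity. *)
  pose K' x := if x \in context_vars G' then
    if insub x is Some k then L k else K (x - ar (act_name c)) else Var x.
  have rK' : realizes G' K'.
    split=> [x X G'x|x /negbTE xG']; last by rewrite /K' xG'.
    have xG' : x \in context_vars G' by apply/context_varsP; exists X.
    rewrite /K' xG'; case: (extend_contextP G'x) => [[mx GX]|[k -> ->]].
      by rewrite insubF; [exact: rK.1 _ _ GX|rewrite ltnNge mx].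
    by rewrite valK; exact: hL.
  move=> /(_ _ rK')/normal_daimon; apply: good_eq.
  (* [t] composes the lifted [K] with the instantiation by [L]. It is compared with [K'] only on the
     free variables of the premise, all of which lie in [G']. *)
  pose t x := subst_neg (instantiate L) (up_subst (ar (act_name c)) K x).
  apply: pos_eq_trans ((subst_subst (s := t) _).1 _) _ => //.
  apply: (subst_eq_fv _ _).1 => // x /fvPc xG'.
  rewrite /K' xG' /t /up_subst; case: ltnP => mx.
    by rewrite substE /instantiate insubT.
  by rewrite insubF; [exact: instantiate_ren|rewrite ltnNge mx].
apply: sim_good.
have E : pos_eq (plug P1 (normal_neg N)) (single (Cut (normal_neg N) _ L)).
  apply: pos_eq_trans (plug_single (normal_neg N) cL).
  exact: (subst_eq_fv _ _).1 EP1.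
apply: SimTrans E _ (pos_eq_refl _); apply: sim_single => [|k].
- exact: neg_sim_unnormal.
- exact: neg_sim_eq.
Qed.

End Soundness.

Theorem theorem3p5 (A : signature) (j : judgement A) :
  derivable j -> models j.
Proof.
elim=> {j} [P G z al Ns c M sP lNs Gz al_c EP _ IH|P G al Ps sP lPs _ IH].
- exact: pos_rule_sound sP Gz al_c EP IH.
- exact: neg_rule_sound sP IH.
Qed.
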